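(* Let $\gamma=\mathcal{N}(0,I_d)$. If $\tilde I(\gamma,p_R)=0$ for almost every orthogonal matrix $R\in\mathbb{R}^{d\times d}$ (with respect to the Haar measure on the orthogonal group), then $p=\gamma$.
   Context: Standing assumptions: $p(\mathbf{x})\propto \exp(-U(\mathbf{x}))$ is a positive, continuously differentiable probability density on $\mathbb{R}^d$, and there exist $c>0$, $m\ge 2$ with $|\log p(\mathbf{x})|\le c(1+\|\mathbf{x}\|_2^m)$ and $\|\nabla\log p(\mathbf{x})\|_2\le c(1+\|\mathbf{x}\|_2^m)$ for a.e. $\mathbf{x}$. For an orthogonal $R$, $p_R$ denotes the density of $RX$ for $X\sim p$, i.e. $p_R(\mathbf{x})=p(R^\top\mathbf{x})$. For a product density $q$, $\mathbb{E}_{q_{-i}}[f(\mathbf{x})]$ denotes the expectation over all coordinates other than $x_i$ under $q$ (a function of $x_i$). The projected Fisher information is $$\tilde I(q,p)=\sum_{i=1}^d \mathbb{E}_{q}\Big[\Big(\mathbb{E}_{q_{-i}}\big[\partial_i\log q(\mathbf{x})-\partial_i\log p(\mathbf{x})\big]\Big)^2\Big].$$ *)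

(* Defs.v *)
From HB Require Import structures.
From mathcomp Require Import all_boot all_order all_algebra.
From mathcomp Require Import all_classical all_reals all_analysis.
Import Order.TTheory GRing.Theory Num.Theory.

Set Implicit Arguments.
Unset Strict Implicit.
Unset Printing Implicit Defensive.

Local Open Scope classical_set_scope.
Local Open Scope ring_scope.

Section Defs.
Variable R : realType.

(* Iterated integral over R^n of f : R^n -> \bar R with respect to the
   product of n copies of the measure  w(t) dt  (dt = Lebesgue measure on R).
   Coordinates are split as x = (x_0, x_1..x_{n-1}).  For nonnegative
   measurable f this is the integral w.r.t. the product measure (Tonelli);
   for integrable f it is that integral as well (Fubini). *)
Fixpoint wint (w : R -> R) (n : nat) : ('rV[R]_n -> \bar R) -> \bar R :=
  match n with
  | 0 => fun f => f 0
  | n'.+1 => fun f =>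
      (\int[@lebesgue_measure R]_t
         ((w t)%:E * wint w (fun y : 'rV[R]_n' =>
                                f (row_mx (const_mx t : 'rV[R]_1) y))))%E
  end.

Definition leb_int (n : nat) (f : 'rV[R]_n -> \bar R) : \bar R :=
  wint (fun _ => 1) f.

Definition leb_ae (n : nat) (P : 'rV[R]_n -> Prop) : Prop :=
  leb_int (fun x => (\1_(~` [set y | P y]) x : R)%:E) = 0%E.

Definition gauss_exp (n : nat) (f : 'rV[R]_n -> \bar R) : \bar R :=
  wint (normal_pdf 0 1) f.

Definition sqnorm (n : nat) (x : 'rV[R]_n) : R := \sum_(i < n) x ord0 i ^+ 2.
Definition enorm (n : nat) (x : 'rV[R]_n) : R := Num.sqrt (sqnorm x).

Definition gauss_dens (n : nat) (x : 'rV[R]_n) : R :=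
  (Num.sqrt (pi *+ 2) ^+ n)^-1 * expR (- (sqnorm x / 2)).

Definition orth_mx (n : nat) (M : 'M[R]_(n, n)) : Prop :=
  M^T *m M = 1%:M.

(* p_R(x) = p(R^T x): in row-vector convention R^T x corresponds to x *m R. *)
Definition rot_dens (n : nat) (p : 'rV[R]_n -> R) (M : 'M[R]_(n, n))
  : 'rV[R]_n -> R := fun x => p (x *m M).

Definition pd (n : nat) (i : 'I_n) (f : 'rV[R]_n -> R) (x : 'rV[R]_n) : R :=
  'D_(delta_mx 0 i) f x.

Definition grad (n : nat) (f : 'rV[R]_n -> R) (x : 'rV[R]_n) : 'rV[R]_n :=
  \row_i pd i f x.

Definition setc (n : nat) (x : 'rV[R]_n) (i : 'I_n) (t : R) : 'rV[R]_n :=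
  \row_j (if j == i then t else x ord0 j).

(* tI(gamma, p) = sum_i E_gamma[ ( E_{gamma_{-i}}[ d_i log gamma - d_i log p ] )^2 ].
   The inner expectation over all coordinates except x_i is computed as the
   gamma-expectation in y of the integrand evaluated at y with its i-th
   coordinate replaced by x_i (the integrand then does not depend on y_i). *)
Definition proj_fisher_gauss (n : nat) (p : 'rV[R]_n -> R) : \bar R :=
  (\sum_(i < n)
     gauss_exp (fun x : 'rV[R]_n =>
       let h := gauss_exp (fun y : 'rV[R]_n =>
                  (pd i (fun z => ln (gauss_dens z)) (setc y i (x ord0 i))
                   - pd i (fun z => ln (p z)) (setc y i (x ord0 i)))%:E) in
       h * h))%E.

Definition Mpt (n : nat) : pointedType := ('M[R]_(n, n) : normedModType R).
Definition borelM (n : nat) : set (set (Mpt n)) :=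
  @open ('M[R]_(n, n) : normedModType R).
Definition MBorel (n : nat) := g_sigma_algebraType (@borelM n).

(* mu is the (normalized) Haar measure of the orth_mx group O(n), seen as a
   Borel measure on matrices concentrated on O(n): a left-invariant Borel
   probability measure on the compact group O(n) (unique). *)
Definition is_haar_On (n : nat) (mu : {measure set (MBorel n) -> \bar R}) : Prop :=
  [/\ mu setT = 1%E,
      mu [set M : MBorel n | ~ orth_mx M] = 0%E &
      forall Q : 'M[R]_(n, n), orth_mx Q ->
        forall A : set (MBorel n), measurable A ->
          mu ((fun M : MBorel n => (Q *m M : MBorel n)) @^-1` A) = mu A].

End Defs.

(* Main.v *)
Require Import Defs.
From HB Require Import structures.
From mathcomp Require Import all_boot all_order all_algebra.
From mathcomp Require Import all_classical all_reals all_analysis.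
From mathcomp Require Import perm measurable_realfun ring lra.
Import Order.TTheory GRing.Theory Num.Theory.
Import numFieldNormedType.Exports.
Local Open Scope classical_set_scope.
Local Open Scope ring_scope.
Set Implicit Arguments.
Unset Strict Implicit.
Unset Printing Implicit Defensive.

(* Put g(x) = log p(x) + |x|^2/2; the goal is that g is constant. For an
   orthogonal M with first row u, the vanishing of the first summand of the
   projected Fisher information says that the mean of the directional derivative
   of g along u, over the hyperplane <x, u> = t weighted by the standard Gaussian
   gamma, is zero for every t. Hence E[g(X) | <X, u> = t] does not depend on t,
   and with c = E[g(X)],
     E[(g(X) - c) phi(<X, u>)] = 0   for every test function phi.
   Haar-almost every M qualifies, so the admissible u are dense in the sphere, and
   by continuity E[(g(X) - c) cos(<X, w> + b)] = 0 for all w and b. Products of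
   cosines are combinations of such functions, and cos(y/sqrt k)^k tends to
   exp(-y^2/2); so (g - c) gamma integrates to zero against every Gaussian bump
   exp(-L^2 |x - a|^2 / 2), and letting L go to infinity gives g(a) = c. *)

(** For the density rotated by M, the score difference along the first coordinate is minus the
    derivative of g along u; this is why g is the function to follow. The weight on the hyperplane
    <x, u> = t is the same lower-dimensional Gaussian for every t, so the mean of that derivative is
    the t-derivative of the mean of g. The obstacle is that expectations are iterated
    one-dimensional integrals tied to a coordinate system, while the argument rotates that system.
    Rotation invariance is obtained from the determinant formula for invertible matrices, which also
    serves the final rescaling. All integrands stay continuous and below a Gaussian: polynomial
    growth is absorbed by exp(|x|^2 / 4), and weighting by gamma leaves exp(-|x|^2 / 4). Cosines are
    bounded by 1 and respect this bound, so every limit is a dominated one and no Fourier inversion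
    occurs. Null sets of R^n are traded for statements at every point: a continuous function that
    violates a bound does so on a box, and boxes have positive measure. *)

Section Continuity.
Variables (R : realType) (T : topologicalType).
Implicit Types f g : T -> R.

Lemma cont_comp (U V : topologicalType) (f : T -> U) (g : U -> V) :
  continuous f -> continuous g -> continuous (fun x => g (f x)).
Proof. by move=> cf cg x; apply: (@continuous_comp T U V f g x); [exact: cf|exact: cg]. Qed.

Lemma cont_cst (U : topologicalType) (c : U) : continuous (fun _ : T => c).
Proof. by move=> x; apply: cvg_cst. Qed.

Lemma contD f g : continuous f -> continuous g -> continuous (fun x => f x + g x).
Proof. by move=> cf cg x; apply: (@cvgD _ R^o _ (nbhs x)); [exact: cf|exact: cg]. Qed.

Lemma contN f : continuous f -> continuous (fun x => - f x).
Proof. by move=> cf x; apply: (@cvgN _ R^o _ (nbhs x)); exact: cf. Qed.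

Lemma contB f g : continuous f -> continuous g -> continuous (fun x => f x - g x).
Proof. by move=> cf cg; apply: contD => //; exact: contN. Qed.

Lemma contM f g : continuous f -> continuous g -> continuous (fun x => f x * g x).
Proof. by move=> cf cg x; apply: (@cvgM R _ (nbhs x)); [exact: cf|exact: cg]. Qed.

Lemma contX f n : continuous f -> continuous (fun x => f x ^+ n).
Proof.
move=> cf; elim: n => [|n IH].
  by under eq_fun do rewrite expr0; exact: cont_cst.
by under eq_fun do rewrite exprS; exact: contM.
Qed.

Lemma cont_expR f : continuous f -> continuous (fun x => expR (f x)).
Proof. by move=> cf; apply: cont_comp cf _; exact: continuous_expR. Qed.

End Continuity.

(** * Entrywise convergence, and splitting off the first coordinate *)

Section Vectors.
Variable R : realType.

Lemma cvg_mx (m n : nat) (T : Type) {F : set_system T} {FF : Filter F}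
    (f : T -> 'M[R]_(m, n)) (l : 'M[R]_(m, n)) :
  (forall i j, f x i j @[x --> F] --> l i j) -> f x @[x --> F] --> l.
Proof.
move=> fl A [P lP PA]; rewrite /= /nbhs /=.
have : F (fun x => forall ij : 'I_m * 'I_n, P ij.1 ij.2 (f x ij.1 ij.2)).
  by apply: filter_forall => -[i j] /=; exact: fl.
by apply: filterS => x Px; apply: PA => i j; exact: (Px (i, j)).
Qed.

Lemma cvg_entry (m n : nat) (T : Type) {F : set_system T} {FF : Filter F}
    (f : T -> 'M[R]_(m, n)) (l : 'M[R]_(m, n)) i j :
  f x @[x --> F] --> l -> f x i j @[x --> F] --> l i j.
Proof. by move=> fl; apply: (@continuous_cvg _ _ _ F FF f (fun M => M i j) l) => //;
   exact: coord_continuous. Qed.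

Lemma continuous_mx (m n : nat) (T : topologicalType) (f : T -> 'M[R]_(m, n)) :
  (forall i j, continuous (fun x => f x i j)) -> continuous f.
Proof. by move=> cf x; apply: (@cvg_mx _ _ _ (nbhs x)) => i j; exact: cf. Qed.

Lemma cvgr_sum (T I : Type) {F : set_system T} {FF : Filter F} (r : seq I)
    (f : I -> T -> R) (l : I -> R) :
  (forall i, f i x @[x --> F] --> l i) ->
  \sum_(i <- r) f i x @[x --> F] --> \sum_(i <- r) l i.
Proof.
move=> fl; elim: r => [|i r IH].
  by rewrite big_nil; under eq_fun do rewrite big_nil; exact: cvg_cst.
rewrite big_cons; under eq_fun do rewrite big_cons.
by apply: (@cvgD _ R^o).
Qed.

Lemma continuous_mulmxr (m n p : nat) (A : 'M[R]_(n, p)) :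
  continuous (fun x : 'M[R]_(m, n) => x *m A).
Proof.
apply: continuous_mx => i j x.
under eq_fun do rewrite mxE.
apply: (@cvgr_sum _ _ (nbhs x)) => k; apply: (@cvgM R).
  exact: coord_continuous.
exact: cvg_cst.
Qed.

Lemma continuous_addr (m n : nat) (v : 'M[R]_(m, n)) :
  continuous (fun x : 'M[R]_(m, n) => x + v).
Proof.
apply: continuous_mx => i j.
under eq_fun do rewrite mxE.
by apply: contD; [exact: coord_continuous|exact: cont_cst].
Qed.

(** Convertible to the argument of f in [wint], so that slices of [wint] and of [iterint] agree by
    computation. *)
Definition consr (n : nat) (t : R) (y : 'rV[R]_n) : 'rV[R]_n.+1 :=
  row_mx (const_mx t : 'rV[R]_1) y.

Lemma consr0 n t (y : 'rV[R]_n) : consr t y 0 ord0 = t.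
Proof.
rewrite /consr (_ : ord0 = lshift n (ord0 : 'I_1)); last exact/val_inj.
by apply: etrans (row_mxEl _ _ _ _) _; rewrite mxE.
Qed.

Lemma consrS n t (y : 'rV[R]_n) j : consr t y 0 (lift ord0 j) = y 0 j.
Proof.
rewrite /consr (_ : lift ord0 j = rshift 1 j); last exact/val_inj.
exact: row_mxEr.
Qed.

Lemma consr_surj n (x : 'rV[R]_n.+1) :
  x = consr (x 0 ord0) (\row_j x 0 (lift ord0 j)).
Proof.
apply/rowP => i; case: (unliftP ord0 i) => [j|] ->; last by rewrite consr0.
by rewrite consrS mxE.
Qed.

Lemma sqnorm_consr n t (y : 'rV[R]_n) :
  sqnorm (consr t y) = t ^+ 2 + sqnorm y.
Proof.
rewrite /sqnorm big_ord_recl consr0; congr (_ + _).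
by apply: eq_bigr => i _; rewrite consrS.
Qed.

Lemma sqnorm_ge0 n (x : 'rV[R]_n) : 0 <= sqnorm x.
Proof. by apply: sumr_ge0 => i _; exact: sqr_ge0. Qed.

Lemma sqnorm_rV0 (x : 'rV[R]_0) : sqnorm x = 0.
Proof. by rewrite /sqnorm big_ord0. Qed.

Lemma cvg_consr n (T : Type) {F : set_system T} {FF : Filter F}
    (s : T -> R) (t : R) (f : T -> 'rV[R]_n) (y : 'rV[R]_n) :
  s x @[x --> F] --> t -> f x @[x --> F] --> y ->
  consr (s x) (f x) @[x --> F] --> consr t y.
Proof.
move=> st fy; apply: cvg_mx => i j; rewrite ord1.
case: (unliftP ord0 j) => [k|] ->.
  under eq_fun do rewrite consrS.
  by rewrite consrS; exact: cvg_entry.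
by under eq_fun do rewrite consr0; rewrite consr0.
Qed.

Lemma continuous_consr n t : continuous (@consr n t).
Proof. by move=> y; apply: (@cvg_consr _ _ (nbhs y)); [exact: cvg_cst|exact: cvg_id]. Qed.

Lemma continuous_sqnorm n : continuous (@sqnorm R n).
Proof.
move=> x; apply: (@cvgr_sum _ _ (nbhs x)) => k.
rewrite [X in _ --> X]expr2; under eq_fun do rewrite expr2.
by apply: (@cvgM R); exact: coord_continuous.
Qed.

(** Dominated convergence speaks of sequences; this turns it into continuity of an integral in a
    parameter. *)
Lemma continuous_seqP (f : R -> R) :
  (forall (u : nat -> R) t, u n @[n --> \oo] --> t ->
     f (u n) @[n --> \oo] --> f t) -> continuous f.
Proof. by move=> fP t; apply/(@cvg_nbhsP _ R^o) => u /fP. Qed.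

End Vectors.

(** * One-dimensional integrals dominated by a Gaussian *)

Section Gauss1D.
Variable R : realType.
Notation mu := (@lebesgue_measure R).

Definition gauss1 (e t : R) : R := expR (- (e * t ^+ 2)).

Lemma gauss1_gt0 e t : 0 < gauss1 e t. Proof. exact: expR_gt0. Qed.

Lemma continuous_gauss1 e : continuous (gauss1 e).
Proof.
move=> t; apply: (cvg_comp _ expR); last exact: continuous_expR.
apply: (@cvgN _ R^o); apply: (@cvgM R); first exact: cvg_cst.
exact: sqr_continuous.
Qed.

(** Up to its peak, exp(-e t^2) is the normal density of variance 1 / (2 e); integrability is
    inherited from there. *)
Lemma gauss1_normal e : 0 < e -> exists2 k : R, 0 < k &
  gauss1 e = (fun t => k * normal_pdf 0 (Num.sqrt ((2 * e)^-1)) t).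
Proof.
move=> e0.
have se : Num.sqrt ((2 * e)^-1) != 0 by rewrite gt_eqF// sqrtr_gt0 invr_gt0 mulr_gt0.
exists (normal_peak (Num.sqrt ((2 * e)^-1)))^-1.
  by rewrite invr_gt0 normal_peak_gt0.
apply/funext => t; rewrite normal_pdfE// mulrA mulVf ?mul1r; last first.
  by rewrite gt_eqF// normal_peak_gt0.
rewrite /gauss1 /normal_fun subr0 sqr_sqrtr ?invr_ge0 ?mulr_ge0 ?ltW//.
congr expR; rewrite mulr2n; field; lra.
Qed.

Lemma integrable_gauss1 e : 0 < e -> mu.-integrable setT (EFin \o gauss1 e).
Proof.
move=> /gauss1_normal[k k0 ->].
rewrite (_ : EFin \o _ = (fun t => k%:E *
    (normal_pdf 0 (Num.sqrt ((2 * e)^-1)) t)%:E)%E); last first.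
  by apply/funext => t /=; rewrite EFinM.
by apply: integrableZl => //; exact: integrable_normal_pdf.
Qed.

Definition gauss_mass (e : R) : R := \int[mu]_t gauss1 e t.

Lemma gauss_mass_ge0 e : 0 <= gauss_mass e.
Proof. by apply: Rintegral_ge0 => t _; exact/ltW/gauss1_gt0. Qed.

Lemma integrable_dom (F : R -> R) C e : 0 < e -> measurable_fun setT F ->
  (forall t, `|F t| <= C * gauss1 e t) -> mu.-integrable setT (EFin \o F).
Proof.
move=> e0 mF FC; apply: (@le_integrable _ _ _ mu _ _ _
    (fun t => C%:E * (gauss1 e t)%:E)%E) => //.
- exact/measurable_EFinP.
- move=> t _ /=; rewrite lee_fin (le_trans (FC t))//.
  by rewrite ler_norm.
- by apply: integrableZl => //; exact: integrable_gauss1.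
Qed.

Lemma Rintegral_bound (F : R -> R) C e : 0 < e -> measurable_fun setT F ->
  (forall t, `|F t| <= C * gauss1 e t) -> `|\int[mu]_t F t| <= C * gauss_mass e.
Proof.
move=> e0 mF FC; have iF := integrable_dom e0 mF FC.
have iG : mu.-integrable setT (EFin \o (fun t => C * gauss1 e t)).
  apply: (@integrable_dom _ `|C| e) => //.
    by apply: measurable_funM => //; apply: continuous_measurable_fun; exact: continuous_gauss1.
  by move=> t; rewrite normrM (gtr0_norm (gauss1_gt0 _ _)).
apply: (le_trans (le_normr_Rintegral measurableT iF)).
rewrite /gauss_mass -RintegralZl//; last exact: integrable_gauss1.
apply: le_Rintegral => //.
rewrite [X in _.-integrable _ X](_ : _ = (fun t => `|(EFin \o F) t|)%E) //.
exact: integrable_abse.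
Qed.

Lemma Rintegral_dct (F_ : nat -> R -> R) (F : R -> R) C e : 0 < e ->
  (forall k, measurable_fun setT (F_ k)) -> measurable_fun setT F ->
  (forall k t, `|F_ k t| <= C * gauss1 e t) ->
  (forall t, F_ k t @[k --> \oo] --> F t) ->
  \int[mu]_t F_ k t @[k --> \oo] --> \int[mu]_t F t.
Proof.
move=> e0 mF_ mF FC FF.
have [iF _ cF] : [/\ mu.-integrable setT (EFin \o F),
    [sequence \int[mu]_t `|(F_ n t)%:E - (F t)%:E|]_n%E @ \oo --> 0%E &
    [sequence \int[mu]_t (F_ n t)%:E]_n%E @ \oo --> (\int[mu]_t (F t)%:E)%E].
  apply: (@dominated_convergence _ _ _ mu setT measurableT
      (fun k t => (F_ k t)%:E) _ (fun t => C%:E * (gauss1 e t)%:E)%E).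
  - by move=> k; apply/measurable_EFinP; exact: mF_.
  - exact/measurable_EFinP.
  - by apply: aeW => t _; apply: cvg_EFin; [exact: nearW|exact: FF].
  - by apply: integrableZl => //; exact: integrable_gauss1.
  - by apply: aeW => t k _; rewrite -EFinM lee_fin.
rewrite /Rintegral; apply: fine_cvg; rewrite fineK//.
exact: integrable_fin_num iF.
Qed.

End Gauss1D.

(** * Iterated integrals: bound and dominated convergence *)

Section IteratedIntegral.
Variable R : realType.
Notation mu := (@lebesgue_measure R).

(* Real-valued counterpart of wint, to be used on continuous functions with
   Gaussian decay only: integrating out one variable preserves this class, so the
   theory goes by induction on n and involves only integrals over R. *)
Fixpoint iterint (n : nat) : ('rV[R]_n -> R) -> R :=
  match n with
  | 0 => fun f => f 0
  | n'.+1 => fun f => \int[mu]_t iterint (fun y : 'rV[R]_n' => f (consr t y))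
  end.

Lemma iterint0 (f : 'rV[R]_0 -> R) : iterint f = f 0. Proof. by []. Qed.
Lemma iterintS n (f : 'rV[R]_n.+1 -> R) :
  iterint f = \int[mu]_t iterint (fun y => f (consr t y)).
Proof. by []. Qed.

Definition gaussv (n : nat) (e : R) (x : 'rV[R]_n) : R := expR (- (e * sqnorm x)).

Definition gauss_bounded (n : nat) (C e : R) (f : 'rV[R]_n -> R) :=
  continuous f /\ forall x, `|f x| <= C * gaussv e x.

Lemma gaussv_gt0 n e (x : 'rV[R]_n) : 0 < gaussv e x. Proof. exact: expR_gt0. Qed.

Lemma gaussv_consr n e t (y : 'rV[R]_n) :
  gaussv e (consr t y) = gauss1 e t * gaussv e y.
Proof. by rewrite /gaussv /gauss1 sqnorm_consr mulrDr opprD expRD. Qed.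

Lemma gaussv_le n e1 e2 (x : 'rV[R]_n) : e1 <= e2 -> gaussv e2 x <= gaussv e1 x.
Proof. by move=> e12; rewrite ler_expR lerN2 ler_wpM2r// sqnorm_ge0. Qed.

Lemma continuous_gaussv n e : continuous (@gaussv n e).
Proof.
apply: cont_expR; apply: contN; apply: contM; first exact: cont_cst.
exact: continuous_sqnorm.
Qed.

Lemma gauss_bounded_slice n C e (f : 'rV[R]_n.+1 -> R) t :
  gauss_bounded C e f -> gauss_bounded (C * gauss1 e t) e (fun y => f (consr t y)).
Proof.
move=> [cf fC]; split => [|y].
  by apply: cont_comp cf; exact: continuous_consr.
by rewrite -mulrA -gaussv_consr.
Qed.

(** The two claims share one induction. The bound in dimension n + 1 needs the slice integral to be
    measurable in t, which follows from its continuity, that is, from convergence in dimension n;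
    convergence in dimension n + 1 needs the bound in dimension n as its dominating function. *)
Lemma iterint_dct_gen n :
  [/\ forall (f : 'rV[R]_n -> R) C e, 0 < e -> gauss_bounded C e f ->
        `|iterint f| <= C * gauss_mass e ^+ n &
      forall (f_ : nat -> 'rV[R]_n -> R) f C e, 0 < e ->
        (forall k, gauss_bounded C e (f_ k)) -> gauss_bounded C e f ->
        (forall x, f_ k x @[k --> \oo] --> f x) ->
        iterint (f_ k) @[k --> \oo] --> iterint f].
Proof.
elim: n => [|n [IHb IHd]].
  split=> [f C e e0 [_ fC]|f_ f C e e0 _ _ ff].
    by rewrite expr0 (le_trans (fC 0))// /gaussv sqnorm_rV0 mulr0 oppr0 expR0.
  exact: ff.
have slc f C e : 0 < e -> gauss_bounded C e f ->
    continuous (fun t => iterint (fun y : 'rV[R]_n => f (consr t y))).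
  move=> e0 fC; apply: continuous_seqP => u t ut.
  have gbB (s : R) : gauss_bounded (C * gauss1 e s) e (fun y => f (consr s y)) by exact: gauss_bounded_slice.
  (* The slice constant C * gauss1 e s varies with s; as gauss1 <= 1, the constant |C| serves all
     slices. *)
  have gbB2 (s : R) : gauss_bounded `|C| e (fun y : 'rV[R]_n => f (consr s y)).
    have [cs bs] := gbB s; split=> // y; apply: (le_trans (bs y)).
    rewrite ler_wpM2r ?(ltW (gaussv_gt0 _ _))//; apply: (le_trans (ler_norm _)).
    rewrite normrM ler_piMr// gtr0_norm ?gauss1_gt0// -expR0 ler_expR oppr_le0.
    by rewrite mulr_ge0 ?sqr_ge0// ltW.
  apply: (IHd _ _ `|C| e) => // x; have [cf _] := fC.
  apply: (@continuous_cvg _ _ _ _ _ (fun k => consr (u k) x) f) => //.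
    exact: cf.
  by apply: cvg_consr => //; exact: cvg_cst.
have slb f C e t : 0 < e -> gauss_bounded C e f ->
    `|iterint (fun y : 'rV[R]_n => f (consr t y))| <= C * gauss_mass e ^+ n * gauss1 e t.
  by move=> e0 /gauss_bounded_slice fC; rewrite mulrAC; exact: IHb.
split=> [f C e e0 fC|f_ f C e e0 f_C fC ff].
  rewrite iterintS exprSr mulrA; apply: Rintegral_bound => //.
    by apply: continuous_measurable_fun; exact: slc fC.
  by move=> t; exact: slb.
apply: (Rintegral_dct (C := C * gauss_mass e ^+ n) e0).
- by move=> k; apply: continuous_measurable_fun; exact: slc (f_C k).
- by apply: continuous_measurable_fun; exact: slc fC.
- by move=> k t; exact: slb.
- move=> t; apply: (IHd _ _ (C * gauss1 e t) e) => //.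
  + by move=> k; exact: gauss_bounded_slice.
  + exact: gauss_bounded_slice.
Qed.

Lemma iterint_bound n (f : 'rV[R]_n -> R) C e : 0 < e -> gauss_bounded C e f ->
  `|iterint f| <= C * gauss_mass e ^+ n.
Proof. by have [+ _] := iterint_dct_gen n; exact. Qed.

Lemma iterint_dct n (f_ : nat -> 'rV[R]_n -> R) f C e : 0 < e ->
  (forall k, gauss_bounded C e (f_ k)) -> gauss_bounded C e f ->
  (forall x, f_ k x @[k --> \oo] --> f x) ->
  iterint (f_ k) @[k --> \oo] --> iterint f.
Proof. by have [_ +] := iterint_dct_gen n; exact. Qed.

End IteratedIntegral.

(** * Affine substitutions on the line *)

Section ChangeOfVariable1D.
Variable R : realType.
Notation mu := (@lebesgue_measure R).

Lemma ge0_integral_affine (G : R -> R) (a b : R) : 0 < a -> continuous G ->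
  (forall t, 0 <= G t) ->
  (\int[mu]_t (G t)%:E = \int[mu]_t (G ((t + b) * a) * a)%:E)%E.
Proof.
move=> a0 cG G0; pose F (t : R^o) : R := (t + b) * a.
have F'E : F^`()%classic = cst a.
  apply/funext => x; rewrite /F derive1E deriveM// deriveD// derive_cst scaler0.
  rewrite add0r derive_id derive_cst addr0.
  exact: mulr1.
rewrite (@increasing_ge0_integration_by_substitutionT _ F G) ?F'E//.
- by move=> x y xy; rewrite /F ltr_pM2r// ltrD2r.
- exact: cont_cst.
- exact: is_cvg_cst.
- exact: is_cvg_cst.
- by apply/gt0_cvgMlNy => //; exact: cvg_addrr_Ny.
- by apply/gt0_cvgMly => //; exact: cvg_addrr.
Qed.

(** Cut at 0, the integral of H becomes the sum over the half-line of H(t) and H(-t), which is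
    symmetric under reflection. *)
Lemma ge0_integral_opp (G : R -> R) : continuous G -> (forall t, 0 <= G t) ->
  (\int[mu]_t (G t)%:E = \int[mu]_t (G (- t))%:E)%E.
Proof.
move=> cG G0.
have cGN : continuous (G \o -%R).
  by apply: cont_comp cG; exact: opp_continuous.
have half (H : R -> R) : continuous H -> (forall t, 0 <= H t) ->
    (\int[mu]_t (H t)%:E = \int[mu]_(t in `[0%R, +oo[) (H (- t))%:E +
                           \int[mu]_(t in `[0%R, +oo[) (H t)%:E)%E.
  move=> cH H0.
  have mH D : measurable_fun D (EFin \o H).
    by apply/measurable_EFinP; apply: measurable_funTS; exact: continuous_measurable_fun.
  rewrite -(setvU `]-oo, (0:R)]%classic) setUC ge0_integral_setU//=; first last.
  - by apply/disj_setPCl.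
  - by move=> x _; rewrite lee_fin.
  - exact: mH.
  - exact: measurableC.
  rewrite -[in X in (X + _)%E](oppr0 R) ge0_integration_by_substitutionNy//; last first.
    exact: continuous_subspaceT.
  by rewrite setCitvl integral_itv_obnd_cbnd//; exact: mH.
rewrite half// half//.
by rewrite addeC; congr (_ + _)%E; apply: eq_integral => t _; rewrite ?opprK.
Qed.

Lemma integral_gauss1 e k : 0 < e ->
  (\int[mu]_t (k * gauss1 e t)%:E = (k * gauss_mass e)%:E)%E.
Proof.
move=> e0; under eq_integral do rewrite EFinM.
rewrite integralZl//; last exact: integrable_gauss1.
rewrite EFinM; congr (_ * _)%E; rewrite /gauss_mass /Rintegral fineK//.
exact: (integrable_fin_num _ (integrable_gauss1 e0)).
Qed.

Lemma EFin_Rintegral (F : R -> R) : mu.-integrable setT (EFin \o F) ->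
  (\int[mu]_t F t)%R%:E = (\int[mu]_t (F t)%:E)%E.
Proof.
by move=> iF; rewrite /Rintegral fineK//; exact: (integrable_fin_num _ iF).
Qed.

(** (t + b)^2 >= t^2 / 2 - b^2, the difference of the two sides being (t + 2 b)^2 / 2. This costs
    half of the rate and the factor exp(e a^2 b^2). *)
Lemma gauss1_affine e (a b : R) : 0 < e -> a != 0 -> exists C e',
  [/\ 0 < C, 0 < e' & forall t, gauss1 e ((t + b) * a) <= C * gauss1 e' t].
Proof.
move=> e0 a0; exists (expR (e * a ^+ 2 * b ^+ 2)), (e * a ^+ 2 / 2).
have a20 : 0 < e * a ^+ 2 by rewrite mulr_gt0// exprn_even_gt0.
split; [exact: expR_gt0|by rewrite divr_gt0|move=> t].
rewrite /gauss1 -expRD ler_expR.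
have : 0 <= (e * a ^+ 2) * (t + b + b) ^+ 2 by rewrite mulr_ge0 ?sqr_ge0// ltW.
nra.
Qed.

(** The nonnegative case is applied to F + C gauss1, nonnegative by the bound on F, and to C gauss1;
    subtracting the two identities gives the signed case. *)
Lemma Rintegral_affine (F : R -> R) C e (a b : R) : 0 < e -> a != 0 ->
  continuous F -> (forall t, `|F t| <= C * gauss1 e t) ->
  `|a| * \int[mu]_t F ((t + b) * a) = \int[mu]_t F t.
Proof.
move=> e0 a0 cF FC.
have ga0 : 0 < gauss1 e 0 by exact: gauss1_gt0.
have C0 : 0 <= C.
  by have := le_trans (normr_ge0 _) (FC 0); rewrite pmulr_lge0.
have pos (G : R -> R) : continuous G -> (forall t, 0 <= G t) ->
  (\int[mu]_t (G t)%:E = \int[mu]_t (`|a| * G ((t + b) * a))%:E)%E.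
  move=> cG G0; have [ap|an|a00] := ltgtP a 0; last by rewrite a00 eqxx in a0.
    rewrite ge0_integral_opp// (@ge0_integral_affine _ (- a) b) ?oppr_gt0//.
      apply: eq_integral => t _; rewrite ltr0_norm// mulrC.
      by rewrite mulrN opprK.
    by apply: cont_comp cG; exact: opp_continuous.
  rewrite (@ge0_integral_affine _ a b)//.
  by apply: eq_integral => t _; rewrite gtr0_norm// mulrC.
have cA : continuous (fun t : R => (t + b) * a).
  apply: contM; last exact: cont_cst.
  by apply: contD; [move=> t; exact: cvg_id|exact: cont_cst].
have [C1 [e1 [C10 e10 hC1]]] := gauss1_affine b e0 a0.
have iF := integrable_dom e0 (continuous_measurable_fun cF) FC.
have cFa : continuous (fun t => F ((t + b) * a)) by exact: cont_comp cF.
have cga : continuous (fun t => gauss1 e ((t + b) * a)).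
  by apply: cont_comp (@continuous_gauss1 R e).
have iFa : mu.-integrable setT (EFin \o (fun t => F ((t + b) * a))).
  apply: (@integrable_dom _ _ (C * C1) e1) => //.
    exact: continuous_measurable_fun.
  by move=> t; apply: (le_trans (FC _)); rewrite -mulrA ler_wpM2l.
have iga : mu.-integrable setT (EFin \o (fun t => gauss1 e ((t + b) * a))).
  apply: (@integrable_dom _ _ C1 e1) => //.
    exact: continuous_measurable_fun.
  by move=> t; rewrite gtr0_norm ?gauss1_gt0.
have ig := integrable_gauss1 e0.
have Cg (G : R -> R) : mu.-integrable setT (EFin \o G) ->
    mu.-integrable setT (EFin \o (fun t => C * G t)).
  by move=> iG; apply: (integrableZl measurableT C iG).
have ID (G H : R -> R) : mu.-integrable setT (EFin \o G) ->
    mu.-integrable setT (EFin \o H) -> mu.-integrable setT (EFin \o (fun t => G t + H t)).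
  by move=> iG iH; apply: (integrableD measurableT iG iH).
have h1 : \int[mu]_t (F t + C * gauss1 e t) =
    \int[mu]_t (`|a| * (F ((t + b) * a) + C * gauss1 e ((t + b) * a))).
  rewrite /Rintegral pos//.
    by apply: contD => //; apply: contM; [exact: cont_cst|exact: continuous_gauss1].
  by move=> t; have := FC t; rewrite ler_norml => /andP[+ _]; rewrite -subr_ge0 opprK addrC.
have h2 : \int[mu]_t (C * gauss1 e t) = \int[mu]_t (`|a| * (C * gauss1 e ((t + b) * a))).
  rewrite /Rintegral pos//.
    by apply: contM; [exact: cont_cst|exact: continuous_gauss1].
  by move=> t; rewrite mulr_ge0// ltW// gauss1_gt0.
move: h1; rewrite RintegralD//; last exact: Cg.
rewrite [X in _ = X -> _]RintegralZl//; last by apply: ID => //; exact: Cg.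
rewrite [X in _ = _ * X -> _]RintegralD//; last exact: Cg.
move: h2; rewrite [X in _ = X -> _]RintegralZl//; last exact: Cg.
by move=> ->; rewrite mulrDr => /addIr.
Qed.

End ChangeOfVariable1D.

(** * Exchange of two one-dimensional integrals *)

Section Fubini.
Variable R : realType.
Notation mu := (@lebesgue_measure R).

(* A function continuous in its first variable is the limit of the functions
   obtained by rounding that variable down to multiples of 1/(k+1). *)
Lemma measurable_caratheodory (F : R -> R -> R) :
  (forall s, measurable_fun setT (F s)) -> (forall t, continuous (F ^~ t)) ->
  measurable_fun setT (fun z : R * R => F z.1 z.2).
Proof.
move=> mF cF.
pose q (k : nat) (s : R) : R := (Num.floor (s * k.+1%:R))%:~R / k.+1%:R.
have q_cvg s : q k s @[k --> \oo] --> s.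
  apply/cvgrPdist_le => e e0; near=> k.
  have k0 : 0 < k.+1%:R :> R by [].
  have /andP[f1 f2] := floor_itv (s * k.+1%:R).
  rewrite intrD in f2.
  have -> : s - q k s = (s * k.+1%:R - (Num.floor (s * k.+1%:R))%:~R) / k.+1%:R.
    by rewrite /q; field; rewrite gt_eqF.
  rewrite normrM normfV (gtr0_norm k0) ger0_norm ?subr_ge0//.
  apply: (@le_trans _ _ (k.+1%:R^-1)).
    by rewrite ler_piMl ?invr_ge0 ?(ltW k0)// lerBlDl ltW.
  by apply: ltW; near: k; exact: near_infty_natSinv_lt (PosNum e0).
apply: (@measurable_fun_cvg _ _ _ _ (fun k z => F (q k z.1) z.2)); last first.
  move=> [s t] _ /=.
  apply: (@continuous_cvg _ _ _ _ _ (fun k => q k s) (F ^~ t)) => //.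
  exact: cF.
move=> k _ B mB; rewrite setTI.
rewrite [X in measurable X](_ : _ = \bigcup_(z : int)
    (([set s : R | Num.floor (s * k.+1%:R) = z] : set R) `*`
     ((F (z%:~R / k.+1%:R)) @^-1` B : set R))); last first.
  apply/seteqP; split=> [[s t] /= Bst|[s t] [z _ [/= <- //]]].
  by exists (Num.floor (s * k.+1%:R)).
apply: countable_bigcupT_measurable => // z.
apply: measurableX; last by rewrite -[X in measurable X]setTI; exact: mF.
have k0 : 0 < k.+1%:R :> R by [].
rewrite [X in measurable X](_ : _ = `[z%:~R / k.+1%:R, (z + 1)%:~R / k.+1%:R[%classic)//.
apply/seteqP; split=> s /=; rewrite in_itv/= ler_pdivrMr// ltr_pdivlMr//.
  by move=> <-; exact: floor_itv.
by move=> /floor_def.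
Unshelve. all: by end_near. Qed.

(** Separate continuity makes F jointly measurable by [measurable_caratheodory], and the product of
    two Gaussians dominates it on the plane. *)
Lemma Rintegral_Fubini (F : R -> R -> R) C e : 0 < e ->
  (forall s, continuous (F s)) -> (forall t, continuous (F ^~ t)) ->
  (forall s t, `|F s t| <= C * (gauss1 e s * gauss1 e t)) ->
  \int[mu]_s \int[mu]_t F s t = \int[mu]_t \int[mu]_s F s t.
Proof.
move=> e0 cF cF' FC.
have mF : measurable_fun setT (fun z : R * R => F z.1 z.2).
  by apply: measurable_caratheodory => // s; exact: continuous_measurable_fun.
have mG : measurable_fun setT (fun z : R * R => `|C| * (gauss1 e z.1 * gauss1 e z.2)).
  apply: measurable_funM => //; apply: measurable_funM.
    by apply: measurableT_comp measurable_fst; apply: continuous_measurable_fun; exact: continuous_gauss1.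
  by apply: measurableT_comp measurable_snd; apply: continuous_measurable_fun; exact: continuous_gauss1.
have iG : (mu \x mu)%E.-integrable setT
    (EFin \o (fun z : R * R => `|C| * (gauss1 e z.1 * gauss1 e z.2))).
  apply/integrable12ltyP; first exact/measurable_EFinP.
  under eq_integral => s _.
    under eq_integral => t _.
      rewrite /= ger0_norm; last by rewrite !mulr_ge0// ltW// gauss1_gt0.
      rewrite mulrA; over.
    rewrite integral_gauss1// mulrAC; over.
  by rewrite integral_gauss1// ltry.
have iF : (mu \x mu)%E.-integrable setT (EFin \o (fun z : R * R => F z.1 z.2)).
  apply: le_integrable iG => //; first exact/measurable_EFinP.
  move=> [s t] _ /=; rewrite lee_fin (le_trans (FC s t))//.
  rewrite normrM normr_id (gtr0_norm (mulr_gt0 (gauss1_gt0 _ _) (gauss1_gt0 _ _))).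
  by rewrite ler_wpM2r ?ler_norm// mulr_ge0// ltW// gauss1_gt0.
have E1 s : (\int[mu]_t F s t)%R%:E = (\int[mu]_t (F s t)%:E)%E.
  apply: EFin_Rintegral; apply: (@integrable_dom _ _ (C * gauss1 e s) e) => //.
    exact: continuous_measurable_fun.
  by move=> t; rewrite -mulrA.
have E2 t : (\int[mu]_s F s t)%R%:E = (\int[mu]_s (F s t)%:E)%E.
  apply: EFin_Rintegral; apply: (@integrable_dom _ _ (C * gauss1 e t) e) => //.
    by apply: continuous_measurable_fun; exact: cF'.
  by move=> s; rewrite -mulrA [X in _ * X]mulrC.
rewrite /Rintegral -/(Rintegral _ _ _); congr fine.
under eq_integral do rewrite E1.
under [RHS]eq_integral do rewrite E2.
exact: (Fubini iF).
Qed.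

End Fubini.

(** * Linearity, affine maps, and agreement with [leb_int] and [gauss_exp] *)

Section IteratedIntegralTheory.
Variable R : realType.
Notation mu := (@lebesgue_measure R).

(** Hiding the constants gives a class closed under linear and affine operations; [gauss_bounded]
    exhibits them where one bound must serve a whole sequence. *)
Definition gauss_decay (n : nat) (f : 'rV[R]_n -> R) :=
  exists C e, 0 < e /\ gauss_bounded C e f.

Lemma gauss_bounded_norm n C e (f : 'rV[R]_n -> R) : gauss_bounded C e f -> gauss_bounded `|C| e f.
Proof.
move=> [cf fC]; split=> // x; apply: (le_trans (fC x)).
by rewrite ler_wpM2r ?ler_norm// ltW// gaussv_gt0.
Qed.

Lemma gauss_bounded_weaken n C C' e e' (f : 'rV[R]_n -> R) : 0 <= C' -> C <= C' -> e' <= e ->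
  gauss_bounded C e f -> gauss_bounded C' e' f.
Proof.
move=> C0 CC ee [cf fC]; split=> // x; apply: (le_trans (fC x)).
apply: (@le_trans _ _ (C' * gaussv e x)).
  by rewrite ler_wpM2r// ltW// gaussv_gt0.
by rewrite ler_wpM2l// gaussv_le.
Qed.

Lemma gauss1_le1 (e t : R) : 0 <= e -> gauss1 e t <= 1.
Proof. by move=> e0; rewrite -expR0 ler_expR oppr_le0 mulr_ge0// sqr_ge0. Qed.

Lemma iterint_slice_cont n (f : 'rV[R]_n.+1 -> R) C e : 0 < e -> gauss_bounded C e f ->
  continuous (fun t => iterint (fun y : 'rV[R]_n => f (consr t y))).
Proof.
move=> e0 fC; apply: continuous_seqP => u t ut.
have gbB (s : R) : gauss_bounded `|C| e (fun y : 'rV[R]_n => f (consr s y)).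
  have := gauss_bounded_slice s (gauss_bounded_norm fC); apply: gauss_bounded_weaken => //.
  by rewrite ler_piMr// gauss1_le1// ltW.
apply: (iterint_dct (C := `|C|) e0) => // x; have [cf _] := fC.
apply: (@continuous_cvg _ _ _ _ _ (fun k => consr (u k) x) f) => //.
  exact: cf.
by apply: cvg_consr => //; exact: cvg_cst.
Qed.

Lemma iterint_slice_bound n (f : 'rV[R]_n.+1 -> R) C e t : 0 < e -> gauss_bounded C e f ->
  `|iterint (fun y : 'rV[R]_n => f (consr t y))| <= C * gauss_mass e ^+ n * gauss1 e t.
Proof. by move=> e0 /gauss_bounded_slice fC; rewrite mulrAC; exact: iterint_bound. Qed.

Lemma iterint_slice_integrable n (f : 'rV[R]_n.+1 -> R) C e : 0 < e -> gauss_bounded C e f ->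
  mu.-integrable setT (EFin \o (fun t => iterint (fun y : 'rV[R]_n => f (consr t y)))).
Proof.
move=> e0 fC; apply: (integrable_dom (C := C * gauss_mass e ^+ n) e0).
  by apply: continuous_measurable_fun; exact: iterint_slice_cont fC.
by move=> t; exact: iterint_slice_bound.
Qed.

Lemma eq_iterint n (f g : 'rV[R]_n -> R) : f =1 g -> iterint f = iterint g.
Proof. by move=> /funext ->. Qed.

Lemma eq_gauss_decay n (f g : 'rV[R]_n -> R) : f =1 g -> gauss_decay f -> gauss_decay g.
Proof. by move=> /funext ->. Qed.

Lemma gauss_decay_slice n (f : 'rV[R]_n.+1 -> R) t :
  gauss_decay f -> gauss_decay (fun y => f (consr t y)).
Proof. by move=> [C [e [e0 /(gauss_bounded_slice t)]]]; exists (C * gauss1 e t), e. Qed.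

Lemma gauss_decayZ n (f : 'rV[R]_n -> R) c : gauss_decay f -> gauss_decay (fun x => c * f x).
Proof.
move=> [C [e [e0 [cf fC]]]]; exists (`|c| * C), e; split => //; split.
  by apply: contM => //; exact: cont_cst.
by move=> x; rewrite normrM -mulrA ler_wpM2l.
Qed.

Lemma gauss_decayD n (f g : 'rV[R]_n -> R) :
  gauss_decay f -> gauss_decay g -> gauss_decay (fun x => f x + g x).
Proof.
move=> [C [e [e0 fC]]] [D [e' [e'0 gD]]].
exists (`|C| + `|D|), (Num.min e e'); split; first by rewrite lt_min e0.
have [cf {}fC] : gauss_bounded `|C| (Num.min e e') f.
  by apply: gauss_bounded_weaken (gauss_bounded_norm fC) => //; rewrite ge_min lexx.
have [cg {}gD] : gauss_bounded `|D| (Num.min e e') g.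
  by apply: gauss_bounded_weaken (gauss_bounded_norm gD) => //; rewrite ge_min lexx orbT.
split; first exact: contD.
by move=> x; rewrite (le_trans (ler_normD _ _))// mulrDl lerD.
Qed.

Lemma iterintZ n (f : 'rV[R]_n -> R) c : gauss_decay f -> iterint (fun x => c * f x) = c * iterint f.
Proof.
elim: n f => [//|n IH] f fd; rewrite !iterintS.
have E t := IH _ (gauss_decay_slice t fd); under eq_fun do rewrite E.
by have [C [e [e0 fC]]] := fd; rewrite RintegralZl//; exact: iterint_slice_integrable fC.
Qed.

Lemma iterintD n (f g : 'rV[R]_n -> R) : gauss_decay f -> gauss_decay g ->
  iterint (fun x => f x + g x) = iterint f + iterint g.
Proof.
elim: n f g => [//|n IH] f g fd gd; rewrite !iterintS.
have E t := IH _ _ (gauss_decay_slice t fd) (gauss_decay_slice t gd).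
under eq_fun do rewrite E.
have [C [e [e0 fC]]] := fd; have [D [e' [e'0 gD]]] := gd.
by rewrite RintegralD//; [exact: iterint_slice_integrable fC|exact: iterint_slice_integrable gD].
Qed.

(** Every slice integral is integrable, so taking real parts level by level loses nothing. *)
Lemma wint1E n (f : 'rV[R]_n -> R) : gauss_decay f ->
  wint (fun _ => 1) (fun x => (f x)%:E) = (iterint f)%:E.
Proof.
elim: n f => [//|n IH] f fd; rewrite iterintS.
have [C [e [e0 fC]]] := fd.
rewrite EFin_Rintegral; last exact: iterint_slice_integrable fC.
rewrite /=; apply: eq_integral => t _; rewrite mul1e.
exact: (IH _ (gauss_decay_slice t fd)).
Qed.

Lemma gauss_dens_gt0 n (x : 'rV[R]_n) : 0 < gauss_dens x.
Proof.
rewrite /gauss_dens mulr_gt0 ?expR_gt0// invr_gt0 exprn_gt0// sqrtr_gt0.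
by rewrite mulrn_wgt0// pi_gt0.
Qed.

Lemma normal_pdf01E (t : R) :
  normal_pdf 0 1 t = (Num.sqrt (pi *+ 2))^-1 * expR (- (t ^+ 2 / 2)).
Proof.
rewrite normal_pdfE ?oner_eq0// /normal_peak /normal_fun expr1n mul1r subr0.
by rewrite mulNr.
Qed.

Lemma gauss_dens_consr n t (y : 'rV[R]_n) :
  gauss_dens (consr t y) = normal_pdf 0 1 t * gauss_dens y.
Proof.
rewrite /gauss_dens normal_pdf01E sqnorm_consr exprS invfM mulrDl opprD expRD.
by rewrite -!mulrA; congr (_ * _); rewrite mulrCA.
Qed.

Lemma normal_pdf01_gt0 (t : R) : 0 < normal_pdf 0 1 t.
Proof.
by rewrite normal_pdf01E mulr_gt0 ?expR_gt0// invr_gt0 sqrtr_gt0 mulrn_wgt0// pi_gt0.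
Qed.

Lemma gauss_dens_rV0 (x : 'rV[R]_0) : gauss_dens x = 1.
Proof. by rewrite /gauss_dens sqnorm_rV0 expr0 invr1 mul0r oppr0 expR0 mulr1. Qed.

Lemma wint_gaussE n (f : 'rV[R]_n -> R) : gauss_decay (fun x => f x * gauss_dens x) ->
  wint (normal_pdf 0 1) (fun x => (f x)%:E) = (iterint (fun x => f x * gauss_dens x))%:E.
Proof.
elim: n f => [|n IH] f fd; first by rewrite /= gauss_dens_rV0 mulr1.
have [C [e [e0 fC]]] := fd.
rewrite iterintS EFin_Rintegral; last exact: iterint_slice_integrable fC.
rewrite /=; apply: eq_integral => t _.
have w0 : normal_pdf 0 1 t != 0 by rewrite gt_eqF// normal_pdf01_gt0.
have fd' : gauss_decay (fun y => f (consr t y) * gauss_dens y).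
  apply: eq_gauss_decay (gauss_decayZ (normal_pdf 0 1 t)^-1 (gauss_decay_slice t fd)) => y.
  by rewrite gauss_dens_consr; field.
rewrite (IH (fun y => f (consr t y)) fd') -EFinM -iterintZ//; congr EFin.
by apply: eq_iterint => y; rewrite gauss_dens_consr mulrCA.
Qed.

Lemma sqr_norml (x : R) : `|x| ^+ 2 = x ^+ 2.
Proof. by rewrite -normrX ger0_norm// sqr_ge0. Qed.

Lemma sqnorm_mulmx_le n (A : 'M[R]_n) : exists2 K, 0 < K &
  forall x, sqnorm (x *m A) <= K * sqnorm x.
Proof.
(* Column j contributes the square of its absolute sum, because |x_i| <= |x|; the term 1 keeps K
   positive when A is zero. *)
exists (1 + \sum_j (\sum_i `|A i j|) ^+ 2).
  by rewrite ltr_wpDr// sumr_ge0// => j _; exact: sqr_ge0.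
move=> x; rewrite mulrDl mul1r; apply: (@le_trans _ _ (\sum_j ((\sum_i `|A i j|) ^+ 2 * sqnorm x))); last first.
  by rewrite mulr_suml lerDr sqnorm_ge0.
rewrite {1}/sqnorm; apply: ler_sum => j _.
rewrite mxE -sqr_norml -[X in _ * X]sqr_sqrtr ?sqnorm_ge0// -exprMn.
  rewrite lerXn2r ?nnegrE ?mulr_ge0 ?sqrtr_ge0// ?sumr_ge0//.
  apply: (le_trans (ler_norm_sum _ _ _)); rewrite mulr_suml.
  apply: ler_sum => i _; rewrite normrM mulrC ler_wpM2l//.
  rewrite -[leLHS]ger0_norm// -sqrtr_sqr ler_wsqrtr// sqr_norml.
  by rewrite /sqnorm (bigD1 i)//= lerDl sumr_ge0// => k _; exact: sqr_ge0.
Qed.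

Lemma sqnormB_le n (x v : 'rV[R]_n) : sqnorm (x - v) <= 2 * (sqnorm x + sqnorm v).
Proof.
rewrite /sqnorm -big_split/= mulr_sumr; apply: ler_sum => i _; rewrite !mxE.
have := sqr_ge0 (x ord0 i + v ord0 i); nra.
Qed.

(** Since x = ((x A + v) - v) A^-1, one has |x|^2 <= 2 K (|x A + v|^2 + |v|^2) with K a bound for
    A^-1. Hence the rate e / (2 K) and the factor exp(e |v|^2). *)
Lemma gauss_decay_affine n (f : 'rV[R]_n -> R) (A : 'M[R]_n) v : A \in unitmx ->
  gauss_decay f -> gauss_decay (fun x => f (x *m A + v)).
Proof.
move=> uA [C [e [e0 [cf fC]]]].
have [K K0 KA] := sqnorm_mulmx_le (invmx A).
exists (`|C| * expR (e * sqnorm v)), (e / (2 * K)).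
have eK : 0 < e / (2 * K) by rewrite divr_gt0// mulr_gt0.
split=> //; split.
  apply: cont_comp cf; apply: cont_comp (@continuous_addr _ _ _ v).
  exact: continuous_mulmxr.
move=> x; apply: (le_trans (fC _)).
apply: (@le_trans _ _ (`|C| * gaussv e (x *m A + v))).
  by rewrite ler_wpM2r ?ler_norm// ltW// gaussv_gt0.
rewrite -mulrA ler_wpM2l// /gaussv -expRD ler_expR.
have : sqnorm x <= K * (2 * (sqnorm (x *m A + v) + sqnorm v)).
  rewrite -{1}(mulmxK uA x) -{1}(addrK v (x *m A)) (le_trans (KA _))//.
  by rewrite ler_pM2l// sqnormB_le.
move=> /(ler_wpM2l (ltW eK)).
rewrite [X in _ <= X](_ : _ = e * (sqnorm (x *m A + v) + sqnorm v)); last first.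
  by field; rewrite gt_eqF.
lra.
Qed.

Lemma iterint_translate n (f : 'rV[R]_n -> R) v : gauss_decay f ->
  iterint (fun x => f (x + v)) = iterint f.
Proof.
elim: n f v => [f v _|n IH f v fd].
  by rewrite !iterint0; congr f; apply/rowP => -[].
have [C [e [e0 fC]]] := fd.
rewrite !iterintS -[RHS](@Rintegral_affine _ _ (C * gauss_mass e ^+ n) e 1 (v 0 ord0))//; last 2 first.
- exact: iterint_slice_cont fC.
- by move=> t; exact: iterint_slice_bound.
rewrite normr1 mul1r; congr Rintegral; apply/funext => t; rewrite mulr1.
rewrite -(IH _ (\row_j v 0 (lift ord0 j)) (gauss_decay_slice _ fd)).
apply: eq_iterint => y; congr f; apply/rowP => i; rewrite mxE.
by case: (unliftP ord0 i) => [j|] ->; rewrite ?consr0// !consrS !mxE.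
Qed.

End IteratedIntegralTheory.

(** * Linear change of variables *)

Section LinearChange.
Variable R : realType.
Notation mu := (@lebesgue_measure R).

(** The change-of-variables formula as a property of the matrix. It is closed under products, so it
    only has to be checked on factors; invertibility is included because it preserves Gaussian
    decay. *)
Definition det_scaling (n : nat) (A : 'M[R]_n) := A \in unitmx /\
  forall f : 'rV[R]_n -> R, gauss_decay f -> `|\det A| * iterint (fun x => f (x *m A)) = iterint f.

Lemma gauss_decay_mulmx n (f : 'rV[R]_n -> R) (A : 'M[R]_n) : A \in unitmx ->
  gauss_decay f -> gauss_decay (fun x => f (x *m A)).
Proof.
by move=> uA /(gauss_decay_affine 0 uA); apply: eq_gauss_decay => x; rewrite addr0.
Qed.

Lemma det_scaling_mul n (A B : 'M[R]_n) : det_scaling A -> det_scaling B -> det_scaling (A *m B).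
Proof.
move=> [uA hA] [uB hB]; split=> [|f fd]; first by rewrite unitmx_mul uA.
rewrite det_mulmx normrM mulrAC.
rewrite (eq_iterint (g := fun x => (fun z => f (z *m B)) (x *m A))); last first.
  by move=> x; rewrite mulmxA.
by rewrite (hA _ (gauss_decay_mulmx uB fd)) mulrC; exact: hB.
Qed.

Lemma det_scaling1 n : det_scaling (1%:M : 'M[R]_n).
Proof.
split=> [|f _]; first exact: unitmx1.
by rewrite det1 normr1 mul1r; apply: eq_iterint => x; rewrite mulmx1.
Qed.

(** The matrix sends (t, y) to (t a, t b + y D). For fixed t the inner variable is transformed by D
    and translated by t b, which is the formula for D; the outer variable is then scaled by a. *)
Lemma det_scaling_block n (a : 'M[R]_1) (b : 'rV[R]_n) (D : 'M[R]_n) :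
  (block_mx a b 0 D : 'M[R]_(1 + n)) \in unitmx -> det_scaling D ->
  det_scaling (block_mx a b 0 D : 'M[R]_(1 + n)).
Proof.
move=> uA [uD hD]; split=> // f fd.
have a0 : a 0 0 != 0.
  move: uA; rewrite unitmxE det_ublock unitfE mulf_eq0 negb_or => /andP[+ _].
  by rewrite [a]mx11_scalar det_scalar1 mxE eqxx mulr1n.
have [C [e [e0 fC]]] := fd.
rewrite det_ublock normrM [\det a]det_mx11.
rewrite [in RHS]iterintS -(@Rintegral_affine _ _ (C * gauss_mass e ^+ n) e (a 0 0) 0)//; last 2 first.
- exact: iterint_slice_cont fC.
- by move=> t; exact: iterint_slice_bound.
rewrite -mulrA; congr (_ * _); rewrite iterintS.
have E t : iterint (fun y : 'rV[R]_n => f (consr t y *m block_mx a b 0 D)) =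
    `|\det D|^-1 * iterint (fun y => f (consr ((t + 0) * a 0 0) y)).
  have fd1 := gauss_decay_slice (t * a 0 0) fd.
  have := hD _ (gauss_decay_affine (t *: b) (unitmx1 _ _) fd1).
  under [X in _ * X = _]eq_iterint do rewrite mulmx1.
  under [RHS]eq_iterint do rewrite mulmx1.
  rewrite (iterint_translate _ fd1) addr0 => <-.
  rewrite mulrA mulVf ?mul1r; last by rewrite normr_eq0 -unitfE -unitmxE.
  apply: eq_iterint => y; congr f.
  have -> : consr t y *m block_mx a b 0 D = _ := mul_row_block (const_mx t) y a b 0 D.
  rewrite mulmx0 addr0 addrC; congr (row_mx _ (_ + _)).
    by apply/rowP => j; rewrite [j]ord1 !mxE big_ord1 !mxE.
  by apply/rowP => j; rewrite !mxE big_ord1 !mxE.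
under eq_fun do rewrite E.
rewrite RintegralZl//; last first.
  have [C1 [e1 [C10 e10 hC1]]] := gauss1_affine 0 e0 a0.
  have mass0 := exprn_ge0 n (gauss_mass_ge0 e).
  apply: (integrable_dom (C := `|C| * gauss_mass e ^+ n * C1) e10).
    apply: continuous_measurable_fun; apply: cont_comp (iterint_slice_cont e0 fC).
    by apply: contM; [apply: contD; [move=> t; exact: cvg_id|exact: cont_cst]|exact: cont_cst].
  move=> t; apply: (le_trans (iterint_slice_bound _ e0 (gauss_bounded_norm fC))).
  by rewrite -[leRHS]mulrA ler_wpM2l// mulr_ge0.
by rewrite mulrA mulfV ?mul1r// normr_eq0 -unitfE -unitmxE.
Qed.

Lemma det_scaling_col0 n (A : 'M[R]_(1 + n)) : A \in unitmx ->
  (forall D : 'M[R]_n, D \in unitmx -> det_scaling D) ->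
  (forall j : 'I_n, A (lift ord0 j) ord0 = 0) -> det_scaling A.
Proof.
move=> uA IH A0; have dl0 : dlsubmx A = 0.
  apply/matrixP => i j; rewrite !mxE ord1.
  rewrite (_ : rshift 1 i = lift ord0 i); last exact/val_inj.
  by rewrite (_ : lshift n 0 = ord0) ?A0//; exact/val_inj.
move: uA; rewrite -{1 2}(submxK A) dl0 => uA; apply: det_scaling_block => //.
apply: IH; move: uA; rewrite !unitmxE det_ublock !unitfE mulf_eq0 negb_or.
by case/andP.
Qed.

Lemma det_scaling_swap n : det_scaling (tperm_mx 0 1 : 'M[R]_n.+2).
Proof.
split=> [|f fd]; first exact: unitmx_perm.
rewrite det_perm normrX normrN1 expr1n mul1r.
have [C [e [e0 fC]]] := fd.
rewrite iterintS; under eq_fun do rewrite iterintS.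
rewrite [in RHS]iterintS; under [in RHS]eq_fun do rewrite iterintS.
rewrite [RHS](@Rintegral_Fubini _
  (fun s t => iterint (fun y => f (consr s (consr t y)))) (C * gauss_mass e ^+ n) e e0).
- congr Rintegral; apply/funext => s; congr Rintegral; apply/funext => t.
  apply: eq_iterint => y; congr f; rewrite -xcolE; apply/rowP => j; rewrite mxE.
  case: tpermP => [->|->|/eqP j0 /eqP j1].
  + by rewrite (_ : 1 = lift ord0 ord0) ?consrS ?consr0//; exact/val_inj.
  + by rewrite (_ : 1 = lift ord0 ord0) ?consrS ?consr0//; exact/val_inj.
  + case: (unliftP ord0 j) j0 j1 => [k -> _|-> //]; rewrite !consrS.
    case: (unliftP ord0 k) => [l -> _|-> /eqP[]]; first by rewrite !consrS.
    exact/val_inj.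
- by move=> s; exact: (iterint_slice_cont e0 (gauss_bounded_slice s fC)).
- move=> t; pose ft (x : 'rV[R]_n.+1) :=
    f (consr (x 0 ord0) (consr t (\row_j x 0 (lift ord0 j)))).
  have gft : gauss_bounded (C * gauss1 e t) e ft.
    have [cf bf] := fC; split=> [|x].
      apply: cont_comp cf => x; apply: (@cvg_consr _ _ _ (nbhs x)).
        exact: coord_continuous.
      apply: (@cvg_consr _ _ _ (nbhs x)); first exact: cvg_cst.
      apply: cvg_mx => i j; under eq_fun do rewrite mxE; rewrite mxE.
      exact: coord_continuous.
    apply: (le_trans (bf _)); rewrite !gaussv_consr -!mulrA.
    have <- : gaussv e (consr (x 0 ord0) (\row_j x 0 (lift ord0 j))) = gaussv e x.
      by rewrite -consr_surj.
    by rewrite gaussv_consr (mulrCA (gauss1 e t)).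
  have -> : (fun s => iterint (fun y : 'rV[R]_n => f (consr s (consr t y)))) =
      (fun s => iterint (fun y : 'rV[R]_n => ft (consr s y))); last exact: iterint_slice_cont e0 gft.
  apply/funext => s; apply: eq_iterint => y; rewrite /ft consr0; congr (f (consr _ (consr _ _))).
  by apply/rowP => j; rewrite mxE consrS.
- move=> s t.
  have := iterint_slice_bound t e0 (gauss_bounded_slice s fC).
  by move=> /le_trans; apply; rewrite [leLHS](_ : _ = C * gauss_mass e ^+ n * (gauss1 e s * gauss1 e t)) //; ring.
Qed.

(* Elimination in the first column: block matrices diag(1, B) reduce it to its
   first two entries, an upper shear clears the first one and the exchange of the
   first two coordinates, which is Fubini's theorem, brings the other to the top. *)
Lemma det_scaling_unitmx n (A : 'M[R]_n) : A \in unitmx -> det_scaling A.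
Proof.
elim: n A => [A _|n IH A uA].
  by rewrite (_ : A = 1%:M); [exact: det_scaling1|apply/matrixP => -[]].
case: n IH A uA => [|n] IH A uA; first by apply: (@det_scaling_col0 0) => // -[].
pose c : 'cV[R]_n.+1 := @dlsubmx R 1 n.+1 1 n.+1 A.
(* c is L times a [pid_mx] times a scalar block, so L^-1 c has at most its first entry nonzero. *)
pose L := col_ebase c.
have uL : L \in unitmx by exact: col_ebase_unit.
pose B : 'M[R]_(1 + n.+1) := block_mx 1%:M 0 0 L.
pose B' : 'M[R]_(1 + n.+1) := block_mx 1%:M 0 0 (invmx L).
have BB' : B *m B' = 1%:M.
  rewrite mulmx_block !mulmx0 !mul0mx !mulmx1 !addr0 add0r mulmxV//.
  by rewrite -scalar_mx_block.
have uB : B \in unitmx by case: (mulmx1_unit BB').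
have uB' : B' \in unitmx by case: (mulmx1_unit BB').
rewrite -[A]mul1mx -BB' -mulmxA; apply: det_scaling_mul.
  by apply: det_scaling_block => //; exact: IH.
set A' := B' *m A.
have uA' : A' \in unitmx by rewrite unitmx_mul uB'.
have A'0 (j : 'I_n) : A' (lift ord0 (lift ord0 j)) ord0 = 0.
  have -> : A' (lift ord0 (lift ord0 j)) ord0 = (invmx L *m c) (lift ord0 j) ord0.
    have EA : A' = _ := etrans (congr1 (mulmx B') (esym (@submxK R 1 n.+1 1 n.+1 A)))
      (mulmx_block _ _ _ _ _ _ _ _).
    transitivity (A' (rshift 1 (lift ord0 j)) (lshift n.+1 (ord0 : 'I_1))).
      by congr (A' _ _); exact/val_inj.
    rewrite EA; apply: etrans (block_mxEdl _ _ _ _ _ _) _.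
    by rewrite mul0mx add0r.
  rewrite -(mulmx_ebase c) !mulmxA mulVmx// mul1mx mxE big_ord1 mxE.
  by rewrite andbF mul0r || rewrite /= mul0r.
have S2 : (tperm_mx 0 1 : 'M[R]_n.+2) *m tperm_mx 0 1 = 1%:M.
  by rewrite -perm_mxM tperm2 perm_mx1.
pose k := A' (lift ord0 ord0) ord0.
have [k0|k0] := eqVneq k 0.
  apply: (@det_scaling_col0 n.+1) => // j.
  by case: (unliftP ord0 j) => [l|] ->.
pose U (r : R) : 'M[R]_n.+2 := 1%:M + r *: delta_mx 0 1.
have UU r : U r *m U (- r) = 1%:M.
  rewrite /U mulmxDl mulmxDr !mul1mx mulmxDr mulmx1 -scalemxAl -scalemxAr.
  rewrite mul_delta_mx_0// !scaler0 addr0 scaleNr addrNK//.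
have uU r : U r \in unitmx by case: (mulmx1_unit (UU r)).
have Ucol r j : (U r) (lift ord0 j) ord0 = 0.
  by rewrite !mxE /= mulr0 addr0.
(* The parameter A' 0 0 / k cancels the corner entry of A2; after the exchange, k on top is the only
   entry left in the column. *)
rewrite -[A']mul1mx -(UU (A' 0 0 / k)) -mulmxA; apply: det_scaling_mul.
  by apply: (@det_scaling_col0 n.+1) => //; exact: Ucol.
set A2 := U _ *m A'.
rewrite -[A2]mul1mx -S2 -mulmxA; apply: det_scaling_mul; first exact: det_scaling_swap.
have A2E i j : A2 i j = A' i j - A' 0 0 / k * (i == 0)%:R * A' 1 j.
  rewrite /A2 /U mulmxDl mul1mx mxE -scalemxAl mxE; congr (_ + _).
  rewrite [LHS]mxE [X in _ * X]mxE (bigD1 1)//= big1 ?addr0 => [|l l1].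
    have -> : (delta_mx 0 1 : 'M[R]_n.+2) i 1 = (i == 0)%:R by rewrite mxE eqxx andbT.
    by rewrite mulNr mulrA.
  by rewrite mxE (negbTE l1) andbF mul0r.
apply: (@det_scaling_col0 n.+1) => //.
  by rewrite unitmx_mul unitmx_perm /A2 unitmx_mul uU.
move=> j; rewrite -xrowE mxE.
have l1 : lift ord0 ord0 = 1 :> 'I_n.+2 by exact/val_inj.
case: (unliftP ord0 j) => [l|] ->.
  rewrite tpermD; last 2 first.
  - by apply/eqP => /(congr1 val).
  - by apply/eqP => /(congr1 val).
  by rewrite A2E A'0 mulr0 mul0r subr0.
rewrite l1 tpermR A2E eqxx mulr1 /k l1.
move: k0; rewrite /k l1 => k0.
by rewrite divfK ?subrr.
Qed.

End LinearChange.

(** * Lower bounds for integrals over boxes *)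

Section Positivity.
Variable R : realType.
Notation mu := (@lebesgue_measure R).

(* Measurability is not assumed, because the iterated integrals of Defs are taken
   of functions whose slices are not known to be measurable. *)
Lemma ge0_le_integral_nomeas (f g : R -> \bar R) : (forall t, 0 <= f t)%E ->
  (forall t, f t <= g t)%E -> (\int[mu]_t f t <= \int[mu]_t g t)%E.
Proof.
move=> f0 fg; have g0 t : (0 <= g t)%E by exact: le_trans (fg t).
rewrite !ge0_integralTE//; apply: le_ereal_sup => _ [h hf <-].
by exists h => // t; exact: le_trans (fg t).
Qed.

Lemma wint_ge0 (w : R -> R) n (f : 'rV[R]_n -> \bar R) : (forall t, 0 <= w t) ->
  (forall x, 0 <= f x)%E -> (0 <= wint w f)%E.
Proof.
move=> w0; elim: n f => [|n IH] f f0 //=.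
by apply: integral_ge0 => t _; rewrite mule_ge0 ?lee_fin//; exact: IH.
Qed.

(** The constant k depends on the weight and the box but not on f, so the induction hypothesis
    applies to all slices at once. The outer variable is confined to a ball on which w exceeds half
    its value at the centre. *)
Lemma wint_box (w : R -> R) : continuous w -> (forall t, 0 < w t) ->
  forall n (x0 : 'rV[R]_n) (r : R), 0 < r -> exists2 k : R, 0 < k &
  forall (f : 'rV[R]_n -> \bar R) (c : R), (forall x, 0 <= f x)%E -> 0 <= c ->
    (forall x : 'rV[R]_n, (forall j, `|x 0 j - x0 0 j| < r) -> (c%:E <= f x)%E) ->
    ((c * k)%:E <= wint w f)%E.
Proof.
move=> cw w0; elim=> [|n IH] x0 r r0.
  by exists 1 => // f c _ _ cf; rewrite mulr1; apply: cf => -[].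
have [k k0 hk] := IH (\row_j x0 0 (lift ord0 j)) r r0.
pose a := x0 0 ord0.
have wa0 : 0 < w a / 2 by rewrite divr_gt0.
have /cvgrPdist_lt/(_ _ wa0)[d /= d0 hd] := cw a.
pose s := Num.min r d.
have s0 : 0 < s by rewrite lt_min r0.
exists (k * (w a / 2) * (s *+ 2)) => [|f c f0 c0 cf].
  by rewrite !mulr_gt0// ?divr_gt0// pmulrn_lgt0.
pose K := c * k * (w a / 2).
have K0 : 0 <= K by rewrite !mulr_ge0// ?ltW// divr_gt0.
rewrite [leLHS](_ : _ = \int[mu]_(t in ball a s) (cst K%:E t))%E; last first.
  rewrite integral_cst//; last exact: measurable_ball.
  rewrite [X in (_ * X)%E](lebesgue_measure_ball a (ltW s0)) -EFinM /K.
  by congr EFin; ring.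
rewrite integral_mkcond /=; apply: ge0_le_integral_nomeas => t.
  by rewrite /patch; case: ifP => // _; rewrite lee_fin.
rewrite /patch; case: ifPn => [|_]; last first.
  apply: mule_ge0; first by rewrite lee_fin ltW.
  by apply: wint_ge0 => // u; exact: ltW.
rewrite inE => tas.
have td : w a / 2 <= w t.
  have := hd t; rewrite /ball_/= => /(_ _); have -> : `|a - t| < d.
    by apply: lt_le_trans tas _; rewrite ge_min lexx orbT.
  by move=> /(_ isT); rewrite ltr_norml => /andP[_]; lra.
rewrite /K mulrC EFinM lee_pmul ?lee_fin ?(ltW wa0) ?mulr_ge0 ?(ltW k0)//.
apply: hk => // x xr; apply: (cf (consr t x)) => j.
case: (unliftP ord0 j) => [i|] ->.
  by rewrite consrS; have := xr i; rewrite mxE.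
by rewrite consr0 distrC (lt_le_trans tas)// ge_min lexx.
Qed.

(** The passage from almost every point to every point: used with weight 1 for the growth bounds and
    with the normal density for the Fisher information. *)
Lemma wint_eq0 (w : R -> R) n (f : 'rV[R]_n -> \bar R) (x0 : 'rV[R]_n) (c : R) : continuous w ->
  (forall t, 0 < w t) -> (forall x, 0 <= f x)%E -> wint w f = 0%E -> 0 < c ->
  ~ (\forall x \near x0, (c%:E <= f x)%E).
Proof.
move=> cw w0 f0 wf0 c0 /nbhs_ballP[r /= r0 hr].
have [k k0 hk] := wint_box cw w0 x0 r0.
have cf (x : 'rV[R]_n) : (forall j, `|x 0 j - x0 0 j| < r) -> (c%:E <= f x)%E.
  by move=> xr; apply: hr; split=> // i j; rewrite ord1 /ball/= distrC; exact: xr.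
have := hk f c f0 (ltW c0) cf.
by rewrite wf0 lee_fin leNgt mulr_gt0.
Qed.

End Positivity.

(** * Growth slower than the Gaussian decays *)

Section Growth.
Variable R : realType.

Lemma poly_growth m : exists2 C : R, 0 < C & forall n (x : 'rV[R]_n),
  1 + enorm x ^+ m <= C * expR (sqnorm x / 4).
Proof.
(* From 1 + s <= K exp(s / K), the m-th power grows like exp(m s / K), and m / K <= 1 / 4. The
   successor keeps K nonzero for m = 0. *)
pose K : R := 4 * m.+1%:R.
have K1 : 1 <= K by rewrite /K -natrM ler1n.
have K0 : 0 < K by exact: lt_le_trans K1.
exists (1 + K ^+ m); first by rewrite addr_gt0// exprn_gt0.
move=> n x; set s := sqnorm x; have s0 : 0 <= s by exact: sqnorm_ge0.
have e1 : 1 <= expR (s / 4) by rewrite -expR0 ler_expR divr_ge0.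
rewrite mulrDl mul1r lerD//.
have h1 : enorm x <= 1 + s.
  rewrite /enorm -/s -(@ger0_norm _ (1 + s)) ?addr_ge0// -sqrtr_sqr ler_wsqrtr//.
  by nra.
have h2 : 1 + s <= K * expR (s / K).
  apply: (@le_trans _ _ (K * (1 + s / K))).
    by rewrite mulrDr mulr1 mulrCA divff ?gt_eqF// mulr1 lerD2r.
  by rewrite ler_pM2l// expR_ge1Dx.
apply: (@le_trans _ _ ((K * expR (s / K)) ^+ m)).
  by rewrite lerXn2r ?nnegrE ?sqrtr_ge0 ?(le_trans h1)// ?mulr_ge0 ?expR_ge0// ?(ltW K0).
rewrite exprMn ler_wpM2l ?exprn_ge0 ?(ltW K0)// -expRM_natl ler_expR.
have m0 : m.+1%:R != 0 :> R by rewrite pnatr_eq0.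
rewrite (_ : _ * _ = s / 4 * (m%:R / m.+1%:R)); last by rewrite /K; field.
by rewrite ler_piMr ?divr_ge0// ler_pdivrMr// mul1r ler_nat.
Qed.

(* The exponent 1/4 is below the 1/2 of gauss_dens, and the bound is invariant under
   rotations. *)
Definition gauss_growth (n : nat) (C : R) (f : 'rV[R]_n -> R) :=
  continuous f /\ forall x, `|f x| <= C * expR (sqnorm x / 4).

Lemma continuous_gauss_dens n : continuous (@gauss_dens R n).
Proof.
apply: contM; first exact: cont_cst.
apply: cont_expR; apply: contN; apply: contM; last exact: cont_cst.
exact: continuous_sqnorm.
Qed.

Definition gpeak (n : nat) : R := (Num.sqrt (pi *+ 2) ^+ n)^-1.

Lemma gpeak_ge0 n : 0 <= gpeak n.
Proof. by rewrite invr_ge0 exprn_ge0 ?sqrtr_ge0. Qed.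

Lemma gauss_growth_bounded n C (f : 'rV[R]_n -> R) : gauss_growth C f ->
  gauss_bounded (C * gpeak n) (1 / 4) (fun x => f x * gauss_dens x).
Proof.
move=> [cf fC]; split=> [|x]; first by apply: contM => //; exact: continuous_gauss_dens.
rewrite normrM (gtr0_norm (gauss_dens_gt0 x)).
apply: (@le_trans _ _ (C * expR (sqnorm x / 4) * gauss_dens x)).
  by rewrite ler_wpM2r// ltW// gauss_dens_gt0.
rewrite /gauss_dens -/(gpeak n) -mulrA [X in C * X]mulrCA -expRD mulrA.
rewrite /gaussv le_eqVlt; apply/orP; left; apply/eqP; congr (_ * expR _).
by field.
Qed.

Lemma gauss_growth_decay n C (f : 'rV[R]_n -> R) : gauss_growth C f ->
  gauss_decay (fun x => f x * gauss_dens x).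
Proof. by move=> /gauss_growth_bounded; exists (C * gpeak n), (1 / 4); split=> //; rewrite divr_gt0. Qed.

Lemma gauss_growth_bound n C B (f h : 'rV[R]_n -> R) : gauss_growth C f -> continuous h ->
  (forall x, `|h x| <= B) -> gauss_growth (C * B) (fun x => f x * h x).
Proof.
move=> [cf fC] ch hB; split=> [|x]; first exact: contM.
by rewrite normrM mulrAC ler_pM.
Qed.

Lemma gauss_growthD n C D (f g : 'rV[R]_n -> R) : gauss_growth C f -> gauss_growth D g ->
  gauss_growth (C + D) (fun x => f x + g x).
Proof.
move=> [cf fC] [cg gD]; split=> [|x]; first exact: contD.
by rewrite (le_trans (ler_normD _ _))// mulrDl lerD.
Qed.

Lemma gauss_growth_cst n (c : R) : gauss_growth `|c| (fun _ : 'rV[R]_n => c).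
Proof.
split=> [|x]; first exact: cont_cst.
by rewrite ler_peMr// -expR0 ler_expR divr_ge0// sqnorm_ge0.
Qed.

Lemma iterint_gauss n : iterint (@gauss_dens R n) = 1.
Proof.
elim: n => [|n IH]; first by rewrite iterint0 gauss_dens_rV0.
rewrite iterintS.
have gd : gauss_decay (@gauss_dens R n).
  by apply: eq_gauss_decay (gauss_growth_decay (gauss_growth_cst n 1)) => x; rewrite mul1r.
have E t : iterint (fun y : 'rV[R]_n => gauss_dens (consr t y)) = normal_pdf 0 1 t.
  transitivity (iterint (fun y : 'rV[R]_n => normal_pdf 0 1 t * gauss_dens y)).
    by apply: eq_iterint => y; rewrite gauss_dens_consr.
  by rewrite iterintZ// IH mulr1.
under eq_fun do rewrite E.
by rewrite /Rintegral integral_normal_pdf.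
Qed.

End Growth.

(** * Differentiation of hyperplane means *)

Section SliceConstancy.
Variable R : realType.
Notation mu := (@lebesgue_measure R).

Lemma expR_slice n t (y : 'rV[R]_n) :
  expR (sqnorm (consr t y) / 4) = expR (t ^+ 2 / 4) * expR (sqnorm y / 4).
Proof. by rewrite sqnorm_consr mulrDl expRD. Qed.

Lemma gauss_growth_slice n C (f : 'rV[R]_n.+1 -> R) t : gauss_growth C f ->
  gauss_growth (C * expR (t ^+ 2 / 4)) (fun y => f (consr t y)).
Proof.
move=> [cf fC]; split=> [|y]; last by rewrite -mulrA -expR_slice.
by apply: cont_comp cf; exact: continuous_consr.
Qed.

Lemma gauss_growth_ge0 n C (f : 'rV[R]_n -> R) : gauss_growth C f -> 0 <= C.
Proof.
move=> [_ /(_ 0)] /(le_trans (normr_ge0 _)).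
by rewrite pmulr_lge0// expR_gt0.
Qed.

(** Differentiation under the integral: by the mean value theorem a difference quotient of G is a
    value of [Dg] at a nearby point, so the growth of [Dg] dominates all quotients. *)
Lemma is_derive_slice n (G Dg : 'rV[R]_n.+1 -> R) C t :
  gauss_growth C G -> gauss_growth C Dg ->
  (forall s y, is_derive s (1 : R) (fun u => G (consr u y)) (Dg (consr s y))) ->
  is_derive t (1 : R) (fun s => iterint (fun y : 'rV[R]_n => G (consr s y) * gauss_dens y))
    (iterint (fun y : 'rV[R]_n => Dg (consr t y) * gauss_dens y)).
Proof.
move=> sG sD dG.
(* The quotient is replaced by the derivative at h = 0 and for |h| > 1. Then one constant B, valid
   for first coordinates of size at most |t| + 1, bounds it for every h, and arbitrary sequences
   tending to 0 can be used. *)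
pose Q (h : R) (y : 'rV[R]_n) : R := if (`|h| <= 1) && (h != 0) then
  h^-1 * (G (consr (h + t) y) - G (consr t y)) else Dg (consr t y).
pose B := C * expR ((`|t| + 1) ^+ 2 / 4).
have C0 := gauss_growth_ge0 sG.
have Dgb s y : `|s| <= `|t| + 1 -> `|Dg (consr s y)| <= B * expR (sqnorm y / 4).
  move=> st; have [_ /(_ (consr s y))/le_trans] := sD; apply.
  rewrite expR_slice mulrA ler_wpM2r ?expR_ge0// ler_wpM2l// ler_expR.
  rewrite ler_wpM2r// ?invr_ge0// -[leLHS]sqr_norml.
  by rewrite lerXn2r ?nnegrE ?addr_ge0.
have sQ h : gauss_growth B (Q h).
  rewrite /Q; have [/andP[h1 h0]|hb] := boolP ((`|h| <= 1) && (h != 0)); last first.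
    have [cD _] := gauss_growth_slice t sD; split=> // y.
    by apply: Dgb; rewrite lerDl.
  split.
    apply: contM; first exact: cont_cst.
    by apply: contB; [have [] := gauss_growth_slice (h + t) sG|have [] := gauss_growth_slice t sG].
  move=> y.
  have cGy : continuous (fun u => G (consr u y)).
    by move=> s; have [/derivable1_diffP/differentiable_continuous] := dG s y.
  have [c ct ->] : exists2 c, `|c| <= `|t| + 1 &
      h^-1 * (G (consr (h + t) y) - G (consr t y)) = Dg (consr c y).
    have [hp|hn|h00] := ltgtP h 0; last by rewrite h00 eqxx in h0.
      have ltt : h + t < t by rewrite gtrDr.
      have [|c cin E] := @MVT R (fun u => G (consr u y)) (fun u => Dg (consr u y)) _ _ ltt
        (fun x _ => dG x y); first exact: continuous_subspaceT.
      exists c.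
        move: cin h1; rewrite in_itv/= => /andP[c1 c2]; rewrite ler_norml => /andP[h1 h2].
        rewrite ler_norml; have := ler_norm t; have := ler_norm (- t); rewrite normrN; lra.
      rewrite -[X in _ * X]opprB E; field; exact: h0.
    have ltt : t < h + t by rewrite ltrDr.
    have [|c cin ->] := @MVT R (fun u => G (consr u y)) (fun u => Dg (consr u y)) _ _ ltt
      (fun x _ => dG x y); first exact: continuous_subspaceT.
    exists c; last by field; exact: h0.
    move: cin h1; rewrite in_itv/= => /andP[c1 c2]; rewrite ler_norml => /andP[h1 h2].
    rewrite ler_norml; have := ler_norm t; have := ler_norm (- t); rewrite normrN; lra.
  exact: Dgb.
pose K h := iterint (fun y : 'rV[R]_n => Q h y * gauss_dens y).
have Q0 y : Q h y @[h --> 0] --> Dg (consr t y).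
  have [dy ey] := dG t y.
  have : h^-1 *: (G (consr (h *: 1 + t) y) - G (consr t y)) @[h --> 0^'] --> Dg (consr t y).
    by rewrite -ey; exact: dy.
  move=> /cvgrPdist_lt hy; apply/cvgrPdist_lt => e e0.
  have := hy e e0; rewrite !near_simpl /= /prop_near1 => hh.
  have hh' : nbhs (0 : R) (fun h => h != 0 ->
     `|Dg (consr t y) - h^-1 *: (G (consr (h *: 1 + t) y) - G (consr t y))| < e) by [].
  apply: filterS hh' => h Ph; rewrite /Q; case: ifPn => [/andP[_ h0]|_].
    by have := Ph h0; rewrite /GRing.scale/= mulr1.
  by rewrite subrr normr0.
have K0 : K h @[h --> 0] --> iterint (fun y : 'rV[R]_n => Dg (consr t y) * gauss_dens y).
  apply/(@cvg_nbhsP _ R^o) => u u0.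
  have e4 : 0 < 1 / 4 :> R by rewrite divr_gt0.
  apply: (iterint_dct e4) => [k||y].
  - exact: (gauss_growth_bounded (sQ (u k))).
  - have -> : (fun y : 'rV[R]_n => Dg (consr t y) * gauss_dens y) =
        (fun y => Q 0 y * gauss_dens y) by apply/funext => y; rewrite /Q eqxx andbF.
    exact: (gauss_growth_bounded (sQ 0)).
  - apply: (@cvgM R); last exact: cvg_cst.
    by have /(@cvg_nbhsP _ R^o) := Q0 y; exact.
have KE : \forall h \near 0^', K h =
    h^-1 *: ((fun s => iterint (fun y : 'rV[R]_n => G (consr s y) * gauss_dens y)) (h *: 1 + t) -
             iterint (fun y : 'rV[R]_n => G (consr t y) * gauss_dens y)).
  near=> h.
  have h0 : h != 0 by near: h; exact: nbhs_dnbhs_neq.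
  have h1 : `|h| <= 1 by near: h; exact: dnbhs0_le.
  have g1 := gauss_growth_decay (gauss_growth_slice (h + t) sG).
  have g2 := gauss_growth_decay (gauss_growth_slice t sG).
  rewrite /GRing.scale/= mulr1 /K.
  rewrite -[X in _ * (_ + X)]mulN1r -(iterintZ (-1) g2) -iterintD//; last exact: gauss_decayZ.
  rewrite -iterintZ; last by apply: gauss_decayD => //; exact: gauss_decayZ.
  by apply: eq_iterint => y; rewrite /Q h1 h0 /=; ring.
have cv : h^-1 *: ((fun s => iterint (fun y : 'rV[R]_n => G (consr s y) * gauss_dens y)) (h *: 1 + t) -
             iterint (fun y : 'rV[R]_n => G (consr t y) * gauss_dens y)) @[h --> 0^'] -->
   iterint (fun y : 'rV[R]_n => Dg (consr t y) * gauss_dens y).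
  apply: cvg_trans (near_eq_cvg KE) _.
  exact: cvg_trans (cvg_app K (@nbhs_dnbhs _ _)) K0.
apply: DeriveDef; first by apply/cvg_ex; exists (iterint (fun y : 'rV[R]_n => Dg (consr t y) * gauss_dens y)); exact: cv.
exact: cvg_lim cv.
Unshelve. all: by end_near. Qed.

(** The slice mean of G has zero derivative, hence is constant, and integrating it against the
    normal density identifies the constant with the overall mean. So the inner integral of G minus
    its mean vanishes on each slice, where [phi] is a constant factor. *)
Lemma ridge_orthogonal n (G Dg : 'rV[R]_n.+1 -> R) C (phi : R -> R) :
  gauss_growth C G -> gauss_growth C Dg ->
  (forall s y, is_derive s (1 : R) (fun u => G (consr u y)) (Dg (consr s y))) ->
  (forall t, iterint (fun y : 'rV[R]_n => Dg (consr t y) * gauss_dens y) = 0) ->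
  iterint (fun x => (G x - iterint (fun z => G z * gauss_dens z)) * phi (x 0 ord0) * gauss_dens x) = 0.
Proof.
move=> sG sD dG D0.
pose H s := iterint (fun y : 'rV[R]_n => G (consr s y) * gauss_dens y).
have Hc s : H s = H 0.
  apply: is_derive_0_is_cst => t; rewrite -(D0 t).
  exact: is_derive_slice sG sD dG.
have slice (psi : R -> R) (F : 'rV[R]_n.+1 -> R) t D : gauss_growth D F ->
    iterint (fun y : 'rV[R]_n => F (consr t y) * psi (consr t y 0 ord0) * gauss_dens (consr t y)) =
    psi t * normal_pdf 0 1 t * iterint (fun y : 'rV[R]_n => F (consr t y) * gauss_dens y).
  move=> /(gauss_growth_slice t)/gauss_growth_decay sF; rewrite -iterintZ//; apply: eq_iterint => y.
  by rewrite consr0 gauss_dens_consr; ring.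
pose c := iterint (fun z => G z * gauss_dens z).
have cE : c = H 0.
  rewrite /c iterintS.
  have E t : iterint (fun y : 'rV[R]_n => G (consr t y) * gauss_dens (consr t y)) =
      H 0 * normal_pdf 0 1 t.
    rewrite -(Hc t) mulrC -[X in X * _]mul1r -(slice (fun=> 1) G t C sG).
    by apply: eq_iterint => y; rewrite mulr1.
  under eq_fun do rewrite E.
  rewrite RintegralZl//; last exact: integrable_normal_pdf.
  by rewrite /Rintegral integral_normal_pdf mulr1.
have sGc : gauss_growth (C + `|- c|) (fun x => G x - c) by apply: gauss_growthD => //; exact: gauss_growth_cst.
rewrite -/c iterintS.
have E t : iterint (fun y : 'rV[R]_n => (G (consr t y) - c) * phi (consr t y 0 ord0) *
    gauss_dens (consr t y)) = 0.
  rewrite (slice phi _ t _ sGc).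
  have g1 := gauss_growth_decay (gauss_growth_slice t sG).
  have g2 : gauss_decay (@gauss_dens R n).
    by apply: eq_gauss_decay (gauss_growth_decay (gauss_growth_cst n 1)) => x; rewrite mul1r.
  rewrite (_ : iterint _ = 0) ?mulr0//.
  transitivity (iterint (fun y : 'rV[R]_n => G (consr t y) * gauss_dens y + (- c) * gauss_dens y)).
    by apply: eq_iterint => y; rewrite mulrBl mulNr.
  rewrite iterintD//; last exact: gauss_decayZ.
  by rewrite iterintZ// iterint_gauss mulr1 -/(H t) Hc -cE subrr.
under eq_fun do rewrite E.
by rewrite /Rintegral integral0.
Qed.

End SliceConstancy.

(** * Powers of cosines tend to a Gaussian *)

Section CosineLimit.
Variable R : realType.

Lemma sin_le (t : R) : `|sin t| <= `|t|.
Proof.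
wlog t0 : t / 0 <= t.
  move=> H; have [/H//|/ltW t0] := leP 0 t.
  by rewrite -normrN -[`|t|]normrN -sinN; apply: H; rewrite oppr_ge0.
have dsin x : x \in `]0, t[%R -> is_derive x (1 : R) sin (cos x) by move=> _; exact: is_derive_sin.
have csin : {within `[0, t], continuous (@sin R)}.
  by apply: continuous_subspaceT => x; exact: continuous_sin.
have [c _] := MVT_segment t0 dsin csin.
rewrite sin0 !subr0 => ->; rewrite normrM ler_piMl//.
exact: cos_max.
Qed.

Lemma cos_half (z : R) : cos z = 1 - 2 * sin (z / 2) ^+ 2.
Proof.
rewrite {1}(splitr z) cosD -!expr2; have := cos2Dsin2 (z / 2); lra.
Qed.

(** By the mean value theorem t - sin t = (1 - cos c) t = 2 sin(c / 2)^2 t <= c^2 t / 2 with c <=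
    t. *)
Lemma sin_ge (t : R) : 0 <= t -> t - sin t <= t ^+ 3 / 2.
Proof.
move=> t0.
have df x : x \in `]0, t[%R -> is_derive x (1 : R) (fun x => x - sin x) (1 - cos x).
  by move=> _; apply: is_deriveB.
have cf : {within `[0, t], continuous (fun x : R => x - sin x)}.
  apply: continuous_subspaceT; apply: contB; first by move=> x; exact: cvg_id.
  by move=> x; exact: continuous_sin.
have [c] := MVT_segment t0 df cf.
rewrite in_itv/= => /andP[c0 ct]; rewrite sin0 !subr0 => ->.
rewrite exprSr mulrAC ler_wpM2r// cos_half opprB addrC subrK.
have h : sin (c / 2) ^+ 2 <= (c / 2) ^+ 2.
  by rewrite -sqr_norml -[leRHS]sqr_norml lerXn2r ?nnegrE// sin_le.
have : c ^+ 2 <= t ^+ 2 by rewrite lerXn2r ?nnegrE.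
rewrite expr_div_n in h; lra.
Qed.

(** With t = z / 2 the error is 2 (t^2 - sin(t)^2) = 2 (t - sin t) (t + sin t), at most 2 (t^3 / 2)
    (2 t) = z^4 / 8. *)
Lemma cos_approx (z : R) : `|cos z - (1 - z ^+ 2 / 2)| <= z ^+ 4 / 8.
Proof.
wlog z0 : z / 0 <= z.
  move=> H; have [/H//|/ltW z0] := leP 0 z.
  by have := H (- z); rewrite cosN sqrrN (_ : (- z) ^+ 4 = z ^+ 4) ?oppr_ge0; [exact|ring].
pose t := z / 2; have t0 : 0 <= t by rewrite divr_ge0.
have h1 := sin_ge t0; have h2 := sin_le t.
have h3 : sin t <= t by rewrite (le_trans (ler_norm _))// -[leRHS]ger0_norm.
have h4 : - t <= sin t.
  by move: h2; rewrite (ger0_norm t0) ler_norml => /andP[].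
have -> : cos z - (1 - z ^+ 2 / 2) = 2 * ((t - sin t) * (t + sin t)).
  by rewrite cos_half -/t /t; field.
have p1 : 0 <= t - sin t by rewrite subr_ge0.
have p2 : 0 <= t + sin t by rewrite addrC -lerBlDr sub0r.
rewrite ger0_norm; last by rewrite !mulr_ge0.
have -> : z ^+ 4 / 8 = 2 * (t ^+ 3 / 2 * (t + t)) by rewrite /t; field.
by rewrite ler_pM2l// ler_pM// lerD2l.
Qed.

(** exp(-u) <= 1 / (1 + u) <= 1 - u + u^2, because (1 + u) (1 - u + u^2) = 1 + u^3. *)
Lemma expRN_approx (u : R) : 0 <= u -> `|expR (- u) - (1 - u)| <= u ^+ 2.
Proof.
move=> u0; rewrite ger0_norm; last first.
  by rewrite subr_ge0 expR_ge1Dx.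
have h : (1 + u) * expR (- u) <= 1.
  by rewrite expRN ler_pdivrMr ?expR_gt0// mul1r expR_ge1Dx.
rewrite lerBlDr -(ler_pM2l (_ : 0 < 1 + u)); last by rewrite ltr_wpDr.
apply: (le_trans h); have : 0 <= u ^+ 3 by rewrite exprn_ge0.
nra.
Qed.

Lemma cos_exp_approx (z : R) : `|cos z - expR (- (z ^+ 2 / 2))| <= z ^+ 4.
Proof.
have h1 := cos_approx z.
have h2 : `|expR (- (z ^+ 2 / 2)) - (1 - z ^+ 2 / 2)| <= (z ^+ 2 / 2) ^+ 2.
  by apply: expRN_approx; rewrite divr_ge0// sqr_ge0.
rewrite distrC in h2.
have -> : cos z - expR (- (z ^+ 2 / 2)) = (cos z - (1 - z ^+ 2 / 2)) +
  ((1 - z ^+ 2 / 2) - expR (- (z ^+ 2 / 2))) by ring.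
apply: (le_trans (ler_normD _ _)); apply: (le_trans (lerD h1 h2)).
have : 0 <= z ^+ 4 by rewrite exprn_even_ge0.
have -> : (z ^+ 2 / 2) ^+ 2 = z ^+ 4 / 4 by field.
lra.
Qed.

Lemma dist_exprn (a b : R) m : `|a| <= 1 -> `|b| <= 1 ->
  `|a ^+ m - b ^+ m| <= m%:R * `|a - b|.
Proof.
move=> a1 b1; elim: m => [|m IH]; first by rewrite !expr0 subrr normr0 mul0r.
have -> : a ^+ m.+1 - b ^+ m.+1 = a * (a ^+ m - b ^+ m) + (a - b) * b ^+ m.
  by rewrite !exprS; ring.
apply: (le_trans (ler_normD _ _)); rewrite -natr1 [leRHS]mulrDl mul1r lerD//.
  by rewrite normrM (le_trans _ IH)// ler_piMl.
by rewrite normrM ler_piMr// normrX exprn_ile1.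
Qed.

(** With z = y / sqrt(k + 1), the limit is the (k + 1)-th power of exp(-z^2 / 2). Both bases lie in
    [-1, 1], so the powers differ by at most (k + 1) z^4 = y^4 / (k + 1). *)
Lemma cvg_cos_pow (y : R) :
  cos (y / Num.sqrt k.+1%:R) ^+ k.+1 @[k --> \oo] --> expR (- (y ^+ 2 / 2)).
Proof.
apply/cvgrPdist_le => e e0; near=> k; rewrite distrC.
have s0 : 0 < Num.sqrt k.+1%:R :> R by rewrite sqrtr_gt0.
set z := y / _.
have z2 : z ^+ 2 = y ^+ 2 / k.+1%:R by rewrite /z expr_div_n sqr_sqrtr.
have -> : expR (- (y ^+ 2 / 2)) = expR (- (z ^+ 2 / 2)) ^+ k.+1.
  by rewrite -expRM_natl; congr expR; rewrite z2; field; rewrite nat1r pnatr_eq0.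
apply: (le_trans (dist_exprn _ _ _)); first exact: cos_max.
  rewrite ger0_norm ?expR_ge0// expR_le1 oppr_le0.
  by rewrite divr_ge0// sqr_ge0.
apply: (@le_trans _ _ (k.+1%:R * z ^+ 4)).
  by rewrite ler_pM2l// cos_exp_approx.
have -> : k.+1%:R * z ^+ 4 = y ^+ 4 / k.+1%:R.
  rewrite (_ : z ^+ 4 = z ^+ 2 * z ^+ 2); last by ring.
  by rewrite !z2; field; rewrite nat1r pnatr_eq0.
rewrite ler_pdivrMr// mulrC -ler_pdivrMr//.
apply: (@le_trans _ _ k%:R); last by rewrite ler_nat.
by near: k; exact: nbhs_infty_ger.
Unshelve. all: by end_near. Qed.

End CosineLimit.

(** * A function orthogonal to all cosine waves vanishes *)

Section Injectivity.
Variables (R : realType) (n : nat) (g : 'rV[R]_n -> R) (C : R).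
Hypothesis sg : gauss_growth C g.

Definition dot (m : nat) (x w : 'rV[R]_m) : R := \sum_i x 0 i * w 0 i.

Lemma continuous_dot m (w : 'rV[R]_m) : continuous (fun x => dot x w).
Proof.
move=> x; apply: (@cvgr_sum _ _ _ (nbhs x)) => i.
apply: (@contM R _ (fun x : 'rV[R]_m => x 0 i) (fun=> w 0 i) _ _ x).
  exact: coord_continuous.
exact: cont_cst.
Qed.

Lemma dotDr m (x w v : 'rV[R]_m) : dot x (w + v) = dot x w + dot x v.
Proof. by rewrite /dot -big_split; apply: eq_bigr => i _; rewrite mxE mulrDr. Qed.

Lemma dotNr m (x w : 'rV[R]_m) : dot x (- w) = - dot x w.
Proof. by rewrite /dot -sumrN; apply: eq_bigr => i _; rewrite mxE mulrN. Qed.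

Lemma dotZr m (x w : 'rV[R]_m) s : dot x (s *: w) = s * dot x w.
Proof. by rewrite /dot mulr_sumr; apply: eq_bigr => i _; rewrite mxE mulrCA. Qed.

Lemma dot_delta m (x : 'rV[R]_m) j : dot x (delta_mx 0 j) = x 0 j.
Proof.
rewrite /dot (bigD1 j)//= big1 ?addr0 ?mxE ?eqxx ?mulr1// => i ij.
by rewrite mxE (negbTE ij) andbF mulr0.
Qed.

Lemma cont_cosdot m (w : 'rV[R]_m) b : continuous (fun x => cos (dot x w + b)).
Proof.
have h : continuous (fun x : 'rV[R]_m => dot x w + b).
  by apply: contD; [exact: continuous_dot|exact: cont_cst].
by apply: cont_comp h _ => t; exact: continuous_cos.
Qed.

(** Orthogonality is required after multiplication by every further wave, of any frequency and
    phase, so that the property survives products; the bound by 1 keeps the integrands dominated. *)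
Definition annihilated (P : 'rV[R]_n -> R) :=
  [/\ continuous P, forall x, `|P x| <= 1 & forall w b,
    iterint (fun x => g x * (cos (dot x w + b) * P x) * gauss_dens x) = 0].

Lemma gauss_decay_test (P : 'rV[R]_n -> R) : continuous P -> (forall x, `|P x| <= 1) ->
  gauss_decay (fun x => g x * P x * gauss_dens x).
Proof. by move=> cP P1; exact: gauss_growth_decay (gauss_growth_bound sg cP P1). Qed.

(** A product of two cosines is half the sum of the cosines of the sum and of the difference of
    their arguments. *)
Lemma annihilatedM (P : 'rV[R]_n -> R) v c : annihilated P ->
  annihilated (fun x => cos (dot x v + c) * P x).
Proof.
move=> [cP P1 P0]; split.
- by apply: contM => //; exact: cont_cosdot.
- by move=> x; rewrite normrM mulr_ile1// cos_max.
have gP u a : gauss_decay (fun x => g x * (cos (dot x u + a) * P x) * gauss_dens x).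
  apply: gauss_decay_test; first by apply: contM => //; exact: cont_cosdot.
  by move=> x; rewrite normrM mulr_ile1// cos_max.
move=> w b.
transitivity (iterint (fun x =>
    2^-1 * (g x * (cos (dot x (w + v) + (b + c)) * P x) * gauss_dens x) +
    2^-1 * (g x * (cos (dot x (w - v) + (b - c)) * P x) * gauss_dens x))).
  apply: eq_iterint => x.
  rewrite !dotDr dotNr.
  rewrite (_ : dot x w + dot x v + (b + c) = (dot x w + b) + (dot x v + c)); last by ring.
  rewrite (_ : dot x w - dot x v + (b - c) = (dot x w + b) - (dot x v + c)); last by ring.
  move: (dot x w + b) (dot x v + c) => A B.
  by rewrite cosD cosB; field.
by rewrite iterintD ?iterintZ ?P0 ?mulr0 ?addr0//; exact: gauss_decayZ.
Qed.

Hypothesis g_ridge : forall w b,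
  iterint (fun x => g x * cos (dot x w + b) * gauss_dens x) = 0.

Lemma annihilated1 : annihilated (fun=> 1).
Proof.
split=> [|x|w b]; [exact: cont_cst|by rewrite normr1|].
by rewrite -[RHS](g_ridge w b); apply: eq_iterint => x; rewrite mulr1.
Qed.

Lemma annihilated_prod (s : seq 'I_n) (v : 'I_n -> 'rV[R]_n) (c : 'I_n -> R) k :
  annihilated (fun x => \prod_(j <- s) cos (dot x (v j) + c j) ^+ k).
Proof.
elim: s => [|j s IH].
  by under [X in annihilated X]eq_fun do rewrite big_nil; exact: annihilated1.
under [X in annihilated X]eq_fun do rewrite big_cons.
have aux (P : 'rV[R]_n -> R) : annihilated P ->
    annihilated (fun x => cos (dot x (v j) + c j) ^+ k * P x).
  move=> aP; elim: k {IH} => [|k IHk].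
    by under [X in annihilated X]eq_fun do rewrite expr0 mul1r.
  by under [X in annihilated X]eq_fun do rewrite exprS -mulrA; exact: annihilatedM.
exact: aux.
Qed.

Lemma cvgr_prod (T I : Type) (F : set_system T) (FF : Filter F) (r : seq I)
    (f : I -> T -> R) (l : I -> R) :
  (forall i, f i x @[x --> F] --> l i) ->
  \prod_(i <- r) f i x @[x --> F] --> \prod_(i <- r) l i.
Proof.
move=> fl; elim: r => [|i r IH].
  by rewrite big_nil; under eq_fun do rewrite big_nil; exact: cvg_cst.
rewrite big_cons; under eq_fun do rewrite big_cons.
by apply: (@cvgM R).
Qed.

Lemma sqnormZ m (c : R) (z : 'rV[R]_m) : sqnorm (c *: z) = c ^+ 2 * sqnorm z.
Proof. by rewrite /sqnorm mulr_sumr; apply: eq_bigr => i _; rewrite mxE exprMn. Qed.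

Lemma gauss_annihilated a L :
  iterint (fun x => g x * expR (- (L ^+ 2 * sqnorm (x - a) / 2)) * gauss_dens x) = 0.
Proof.
(* With this frequency the j-th argument is L (x_j - a_j) / sqrt(k + 1), and the (k + 1)-th power of
   its cosine tends to one factor of the Gaussian bump. *)
pose q k : R := L / Num.sqrt k.+1%:R.
pose P k (x : 'rV[R]_n) : R := \prod_(j <- index_enum 'I_n)
  cos (dot x (q k *: delta_mx 0 j) + (- (q k * a 0 j))) ^+ k.+1.
have aP k : annihilated (P k) by exact: annihilated_prod.
have e4 : 0 < 1 / 4 :> R by rewrite divr_gt0.
have cE : continuous (fun x : 'rV[R]_n => expR (- (L ^+ 2 * sqnorm (x - a) / 2))).
  apply: cont_expR; apply: contN; apply: contM; last exact: cont_cst.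
  apply: contM; first exact: cont_cst.
  by apply: cont_comp (@continuous_sqnorm R n); exact: continuous_addr.
have E1 (x : 'rV[R]_n) : `|expR (- (L ^+ 2 * sqnorm (x - a) / 2))| <= 1.
  rewrite ger0_norm ?expR_ge0// expR_le1 oppr_le0.
  by rewrite divr_ge0// mulr_ge0 ?sqr_ge0 ?sqnorm_ge0.
have lim : iterint (fun x => g x * P k x * gauss_dens x) @[k --> \oo] -->
    iterint (fun x => g x * expR (- (L ^+ 2 * sqnorm (x - a) / 2)) * gauss_dens x).
  apply: (iterint_dct (C := C * 1 * gpeak R n) e4).
  - move=> k; apply: gauss_growth_bounded; apply: gauss_growth_bound => //; first by have [] := aP k.
    by have [] := aP k.
  - by apply: gauss_growth_bounded; apply: gauss_growth_bound.
  - move=> x; apply: (@cvgM R); last exact: cvg_cst.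
    apply: (@cvgM R); first exact: cvg_cst.
    have -> : expR (- (L ^+ 2 * sqnorm (x - a) / 2)) =
        \prod_(j <- index_enum 'I_n) expR (- ((L * (x 0 j - a 0 j)) ^+ 2 / 2)).
      rewrite -expR_sum; congr expR; rewrite sumrN /sqnorm mulr_sumr mulr_suml.
      by congr (- _); apply: eq_bigr => j _; rewrite !mxE exprMn.
    apply: cvgr_prod => j.
    have E k : dot x (q k *: delta_mx 0 j) + (- (q k * a 0 j)) =
        L * (x 0 j - a 0 j) / Num.sqrt k.+1%:R.
      by rewrite dotZr dot_delta /q; ring.
    by under eq_fun do rewrite E; exact: cvg_cos_pow.
have zero : (fun k => iterint (fun x => g x * P k x * gauss_dens x)) = (fun=> 0).
  apply/funext => k; have [_ _ /(_ 0 0) <-] := aP k; apply: eq_iterint => x.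
  by rewrite addr0 (_ : dot x 0 = 0) ?cos0 ?mul1r// /dot big1// => i _; rewrite mxE mulr0.
rewrite zero in lim.
have := cvg_unique _ lim (cvg_cst (0 : R)); exact.
Qed.

(** The substitution z -> x + z / (k + 1) turns the bump of width 1 / (k + 1) around x into the
    fixed weight exp(-|z|^2 / 2), so that concentration becomes a dominated limit: F(x) times the
    mass of the weight is 0. *)
Lemma ridge_injective x : g x = 0.
Proof.
have [cg gC] := sg.
pose F (z : 'rV[R]_n) := g z * gauss_dens z.
have [cF Fb] : gauss_bounded (C * gpeak R n) (1 / 4) F := gauss_growth_bounded sg.
pose B := C * gpeak R n.
have B0 : 0 <= B by rewrite mulr_ge0 ?gpeak_ge0// (gauss_growth_ge0 sg).
have FB z : `|F z| <= B.
  apply: (le_trans (Fb z)); rewrite ler_piMr// -expR0 ler_expR oppr_le0.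
  by rewrite mulr_ge0 ?sqnorm_ge0// divr_ge0.
pose f k (z : 'rV[R]_n) := F (k.+1%:R^-1 *: z + x) * gaussv (1 / 2) z.
have h2 : 0 < 1 / 2 :> R by rewrite divr_gt0.
have cf k : continuous (f k).
  apply: contM; last exact: continuous_gaussv.
  apply: cont_comp cF; apply: cont_comp (@continuous_addr _ _ _ x).
  rewrite (_ : GRing.scale _ = (fun z : 'rV[R]_n => z *m (k.+1%:R^-1)%:M)).
    exact: continuous_mulmxr.
  by apply/funext => z; rewrite mul_mx_scalar.
have fB k z : `|f k z| <= B * gaussv (1 / 2) z.
  by rewrite normrM (gtr0_norm (gaussv_gt0 _ _)) ler_wpM2r// ltW// gaussv_gt0.
have f0 k : iterint (f k) = 0.
  pose h (z : 'rV[R]_n) := F z * expR (- (k.+1%:R ^+ 2 * sqnorm (z - x) / 2)).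
  have gdh : gauss_decay h.
    apply: eq_gauss_decay (gauss_growth_decay (gauss_growth_bound (B := 1) (h := fun z =>
      expR (- (k.+1%:R ^+ 2 * sqnorm (z - x) / 2))) sg _ _)).
    - by move=> z; rewrite /h /F mulrAC.
    - apply: cont_expR; apply: contN; apply: contM; last exact: cont_cst.
      apply: contM; first exact: cont_cst.
      by apply: cont_comp (@continuous_sqnorm R n); exact: continuous_addr.
    - move=> z; rewrite ger0_norm ?expR_ge0// expR_le1 oppr_le0.
      by rewrite divr_ge0// mulr_ge0 ?sqr_ge0 ?sqnorm_ge0.
  have h0 : iterint h = 0.
    by rewrite -[RHS](gauss_annihilated x k.+1%:R); apply: eq_iterint => z; rewrite /h /F mulrAC.
  have k0 : k.+1%:R != 0 :> R by rewrite pnatr_eq0.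
  have uA : ((k.+1%:R^-1)%:M : 'M[R]_n) \in unitmx.
    by rewrite unitmxE det_scalar unitfE expf_neq0// invr_neq0.
  have [_ lA] := det_scaling_unitmx uA.
  have gdh1 : gauss_decay (fun z => h (z + x)).
    by apply: eq_gauss_decay (gauss_decay_affine x (unitmx1 _ _) gdh) => z; rewrite mulmx1.
  have := lA _ gdh1; rewrite (iterint_translate _ gdh) h0 => /eqP.
  rewrite mulf_eq0 normr_eq0 -[_ == 0]negbK -unitfE -unitmxE uA /= => /eqP <-.
  apply: eq_iterint => z; rewrite mul_mx_scalar /h /f /gaussv; congr (_ * expR (- _)).
  by rewrite addrK sqnormZ; field; rewrite nat1r.
have lim : iterint (f k) @[k --> \oo] --> iterint (fun z : 'rV[R]_n => F x * gaussv (1 / 2) z).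
  apply: (iterint_dct (C := B) h2) => //.
    split; first by apply: contM; [exact: cont_cst|exact: continuous_gaussv].
    by move=> z; rewrite normrM (gtr0_norm (gaussv_gt0 _ _)) ler_wpM2r// ltW// gaussv_gt0.
  move=> z; apply: (@cvgM R); last exact: cvg_cst.
  apply: (@continuous_cvg _ _ _ _ _ (fun k => k.+1%:R^-1 *: z + x) F).
    exact: cF.
  apply: cvg_mx => i j; under eq_fun do rewrite !mxE.
  have : k.+1%:R^-1 * z i j + x i j @[k --> \oo] --> 0 * z i j + x i j.
    apply: (@cvgD _ R^o); last exact: cvg_cst.
    by apply: (@cvgM R); [exact: cvg_harmonic|exact: cvg_cst].
  by rewrite mul0r add0r.
have {}lim : iterint (fun z : 'rV[R]_n => F x * gaussv (1 / 2) z) = 0.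
  move: lim; under eq_fun do rewrite f0.
  by move=> lim; have := cvg_unique _ lim (cvg_cst (0 : R)); exact.
have gdg : gauss_decay (@gauss_dens R n).
  by apply: eq_gauss_decay (gauss_growth_decay (gauss_growth_cst n 1)) => z; rewrite mul1r.
have s0 : 0 < Num.sqrt (pi *+ 2) :> R by rewrite sqrtr_gt0 mulrn_wgt0// pi_gt0.
(* The fixed weight is a multiple of [gauss_dens], whose integral is 1, so its mass is nonzero. *)
have : iterint (fun z : 'rV[R]_n => F x * (Num.sqrt (pi *+ 2) ^+ n) * gauss_dens z) = 0.
  rewrite -lim; apply: eq_iterint => z; rewrite -mulrA; congr (_ * _).
  rewrite /gauss_dens mulrA mulfV ?mul1r ?expf_neq0 ?gt_eqF// /gaussv; congr (expR (- _)).
  by field.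
rewrite iterintZ// iterint_gauss mulr1 => /eqP; rewrite mulf_eq0 expf_eq0 [X in _ || (_ && X)]gt_eqF// andbF orbF.
by rewrite /F mulf_eq0 [X in _ || X]gt_eqF ?gauss_dens_gt0// orbF => /eqP.
Qed.

End Injectivity.

(** * Orthogonal matrices *)

Section Orthogonal.
Variable R : realType.

Lemma orth_mxT n (M : 'M[R]_n) : orth_mx M -> M *m M^T = 1%:M.
Proof. by move=> /mulmx1C. Qed.

Lemma orth_unitmx n (M : 'M[R]_n) : orth_mx M -> M \in unitmx.
Proof. by case/mulmx1_unit. Qed.

Lemma orth_tr n (M : 'M[R]_n) : orth_mx M -> orth_mx M^T.
Proof. by move=> /orth_mxT; rewrite /orth_mx trmxK. Qed.

Lemma orth_mul n (M N : 'M[R]_n) : orth_mx M -> orth_mx N -> orth_mx (M *m N).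
Proof.
by rewrite /orth_mx => hM hN; rewrite trmx_mul -mulmxA (mulmxA M^T) hM mul1mx.
Qed.

Lemma orth_det n (M : 'M[R]_n) : orth_mx M -> `|\det M| = 1.
Proof.
move=> /(congr1 determinant); rewrite det_mulmx det_tr det1 => h.
by apply/eqP; rewrite -(@eqrXn2 _ 2)// expr1n -normrX expr2 h normr1.
Qed.

Lemma orth_sqnorm n (M : 'M[R]_n) x : orth_mx M -> sqnorm (x *m M) = sqnorm x.
Proof.
have sqE (z : 'rV[R]_n) : sqnorm z = (z *m z^T) 0 0.
  by rewrite /sqnorm mxE; apply: eq_bigr => i _; rewrite mxE expr2.
by move=> /orth_mxT h; rewrite !sqE trmx_mul -mulmxA (mulmxA M) h mul1mx.
Qed.

Lemma orth_entry n (M : 'M[R]_n) i j : orth_mx M -> `|M i j| <= 1.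
Proof.
move=> /(congr1 (fun A : 'M[R]_n => A j j)); rewrite !mxE eqxx mulr1n => h.
have : `|M i j| ^+ 2 <= 1.
  rewrite sqr_norml -h (bigD1 i)//= mxE -expr2 lerDl sumr_ge0// => k _.
  by rewrite mxE -expr2 sqr_ge0.
by rewrite expr_le1.
Qed.

Lemma orth1 n : orth_mx (1%:M : 'M[R]_n).
Proof. by rewrite /orth_mx trmx1 mulmx1. Qed.

(* The Householder reflection exchanging e_0 and u. *)
Lemma orth_row0 n (u : 'rV[R]_n.+1) : sqnorm u = 1 ->
  exists2 M : 'M[R]_n.+1, orth_mx M & row 0 M = u.
Proof.
move=> u1; pose e : 'rV[R]_n.+1 := delta_mx 0 0; pose v := u - e.
have sqE (z : 'rV[R]_n.+1) : z *m z^T = (sqnorm z)%:M.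
  rewrite [LHS]mx11_scalar; congr (_%:M); rewrite /sqnorm mxE.
  by apply: eq_bigr => i _; rewrite mxE expr2.
have [v0|v0] := eqVneq (sqnorm v) 0.
  have uE : u = e.
    apply/rowP => i; apply/eqP; rewrite -subr_eq0.
    have /eqP := v0; rewrite /sqnorm psumr_eq0; last by move=> k _; exact: sqr_ge0.
    move=> /allP/(_ i (mem_index_enum _)); rewrite /= sqrf_eq0.
    by rewrite /v 2!mxE.
  exists 1%:M; first exact: orth1.
  by rewrite row1 uE.
pose M : 'M[R]_n.+1 := 1%:M - (2 / sqnorm v) *: (v^T *m v).
have MT : M^T = M.
  by rewrite /M raddfB/= trmx1 linearZ/= trmx_mul trmxK.
have vv : (v^T *m v) *m (v^T *m v) = sqnorm v *: (v^T *m v).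
  by rewrite -mulmxA (mulmxA v) sqE -mul_scalar_mx mulmxA scalar_mxC mulmxA.
exists M.
  rewrite /orth_mx MT /M mulmxBr mulmx1 mulmxBl mul1mx -scalemxAl -scalemxAr vv !scalerA.
  have -> : 2 / sqnorm v * (2 / sqnorm v) * sqnorm v = 2 / sqnorm v + 2 / sqnorm v.
    by field.
  by apply/matrixP => i j; rewrite !mxE; ring.
have ej j : e 0 (lift ord0 j) = 0 by rewrite mxE.
have ee : e 0 ord0 = 1 by rewrite mxE.
have eE j : (0 == j :> 'I_n.+1)%:R = e 0 j by rewrite mxE eqxx eq_sym.
clearbody e.
(* This uses |u| = 1. As v_0 = u_0 - 1, the coefficient 2 v_0 / |v|^2 is -1, and row 0 of the
   reflection is e + v = u. *)
have sv : sqnorm v = 2 * (1 - u 0 ord0).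
  have := u1; rewrite /sqnorm !big_ord_recl /v !mxE ee.
  under [in X in _ -> X]eq_bigr do rewrite !mxE ej subr0.
  by move=> h; have -> : \sum_(i < n) u 0 (lift ord0 i) ^+ 2 = 1 - u 0 ord0 ^+ 2;
    [rewrite -h|]; ring.
apply/rowP => j; rewrite !mxE big_ord1 !mxE.
have uu : 1 - u 0 ord0 != 0 by move: v0; rewrite sv mulf_eq0 negb_or => /andP[].
rewrite eE sv.
by rewrite ee; field; exact: uu.
Qed.

End Orthogonal.

(** * Sets of full Haar measure are dense in the orthogonal group *)

Section HaarDensity.
Variables (R : realType) (n : nat) (mu : {measure set (MBorel R n) -> \bar R}).

Lemma MBorel_open (U : set 'M[R]_n) : open U -> measurable (U : set (MBorel R n)).
Proof. by move=> oU; apply: sub_sigma_algebra. Qed.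

Lemma continuous_mulmxl (Q : 'M[R]_n) : continuous (fun M : 'M[R]_n => Q *m M).
Proof.
apply: continuous_mx => i j x.
under eq_fun do rewrite mxE.
apply: (@cvgr_sum _ _ _ (nbhs x)) => k.
apply: (@contM R _ (fun=> Q i k) (fun M : 'M[R]_n => M k j) _ _ x).
  exact: cont_cst.
exact: coord_continuous.
Qed.

Lemma open_box (M0 Q : 'M[R]_n) (e : R) :
  open [set M : 'M[R]_n | forall i j, `|(Q *m M) i j - M0 i j| < e].
Proof.
have o (ij : 'I_n * 'I_n) : open [set M : 'M[R]_n | `|(Q *m M) ij.1 ij.2 - M0 ij.1 ij.2| < e].
  apply: (@open_comp _ _ (fun M : 'M[R]_n => `|(Q *m M) ij.1 ij.2 - M0 ij.1 ij.2|)
    [set t | t < e]); last exact: open_lt.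
  move=> M _; have c1 : continuous (fun M : 'M[R]_n => (Q *m M) ij.1 ij.2 - M0 ij.1 ij.2).
    apply: contB; last exact: cont_cst.
    exact: (cont_comp (@continuous_mulmxl Q) (@coord_continuous R n n _ _)).
  by have := cont_comp c1 (@norm_continuous _ R^o); exact.
rewrite openE => M h.
have : nbhs M (fun N : 'M[R]_n => forall ij : 'I_n * 'I_n,
    `|(Q *m N) ij.1 ij.2 - M0 ij.1 ij.2| < e).
  apply: (@filter_forall _ _ (fun ij => [set N : 'M[R]_n |
    `|(Q *m N) ij.1 ij.2 - M0 ij.1 ij.2| < e]) (nbhs M)) => ij; apply: open_nbhs_nbhs; split; first exact: o.
  exact: h.
by apply: filterS => N hN i j; exact: (hN (i, j)).
Qed.

Lemma open_not_orth : open [set M : 'M[R]_n | ~ orth_mx M].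
Proof.
rewrite openE => M oM.
have [i [j ij]] : exists i j, (M^T *m M) i j != (1%:M : 'M[R]_n) i j.
  apply: contrapT => h; apply: oM; apply/matrixP => i j; apply/eqP.
  by apply: contrapT => /negP ij; apply: h; exists i, j.
pose f (N : 'M[R]_n) : R := \sum_k N k i * N k j.
have fE N : (N^T *m N) i j = f N by rewrite mxE; apply: eq_bigr => k _; rewrite mxE.
have cf : continuous f.
  move=> x; apply: (@cvgr_sum _ _ _ (nbhs x)) => k.
  by apply: (@contM R _ (fun N : 'M[R]_n => N k i) (fun N : 'M[R]_n => N k j) _ _ x);
    exact: coord_continuous.
rewrite fE in ij.
have : nbhs M (f @^-1` [set t | t != (1%:M : 'M[R]_n) i j]).
  apply: open_nbhs_nbhs; split=> //; apply: open_comp; last exact: open_neq.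
  by move=> x _; exact: cf.
by apply: filterS => N /= Nij oN; move: Nij; rewrite -fE oN eqxx.
Qed.

(* O(n) is covered by the countably many cells {M | floor(K M) = z}, and each cell
   lies in a left translate of the given neighbourhood of M0; so that neighbourhood
   cannot be negligible. *)
Lemma haar_dense (P : 'M[R]_n -> Prop) (M0 : 'M[R]_n) (e : R) : is_haar_On mu ->
  {ae mu, forall M : MBorel R n, P M} -> orth_mx M0 -> 0 < e ->
  exists M : 'M[R]_n, [/\ orth_mx M, P M & forall i j, `|M i j - M0 i j| < e].
Proof.
move=> [mu1 muN inv] [A [mA A0 PA]] oM0 e0; apply: contrapT => /forallNP no.
pose U : set (MBorel R n) := [set M | forall i j, `|(1%:M *m M) i j - M0 i j| < e].
have mU : measurable U by apply: MBorel_open; exact: open_box.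
pose N : set (MBorel R n) := [set M | ~ orth_mx M].
have nN : mu.-negligible N.
  by apply/negligibleP => //; apply: MBorel_open; exact: open_not_orth.
have U0 : mu U = 0%E.
  apply: measure_negligible => //.
  apply: (negligibleS (A := A `|` N)); last first.
    by apply: negligibleU => //; exact/negligibleP.
  move=> M UM; have [oM|] := pselect (orth_mx M); last by right.
  left; apply: PA => /= PM; apply: (no M); split=> // i j.
  by have := UM i j; rewrite mul1mx.
(* Two matrices of one cell differ by at most 1 / K in each entry; multiplication by an orthogonal
   matrix, with entries at most 1, turns this into at most n / K. *)
have [K K0 Ke] : exists2 K : R, 0 < K & n%:R / K < e.
  exists (n.+1%:R / e); first by rewrite divr_gt0.
  by rewrite invf_div mulrCA gtr_pMr// ltr_pdivrMr// mul1r ltr_nat.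
pose cell (M : 'M[R]_n) : 'M[int]_n := map_mx (fun t => Num.floor (t * K)) M.
(* An orthogonal matrix chosen in the cell; a cell that misses O(n) gets the identity, so that [rep]
   is always orthogonal. *)
pose rep (z : 'M[int]_n) : 'M[R]_n :=
  if pselect (exists M, orth_mx M /\ cell M = z) is left h then projT1 (cid h) else 1%:M.
have rep_orth z : orth_mx (rep z).
  rewrite /rep; case: pselect => [h|_]; last exact: orth1.
  by case: (cid h) => M [].
have rep_cell M : orth_mx M -> cell (rep (cell M)) = cell M.
  move=> oM; rewrite /rep; case: pselect => [h|[]]; last by exists M.
  by case: (cid h) => M' [].
(* Left multiplication by M0 rep(z)^T carries rep(z) to M0, hence the orthogonal matrices of its
   cell into U; by invariance V z is null like U. *)
pose V (z : 'M[int]_n) : set (MBorel R n) :=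
  (fun M : MBorel R n => ((M0 *m (rep z)^T) *m M : MBorel R n)) @^-1` U.
have nV z : mu.-negligible (V z).
  apply/negligibleP.
    rewrite [X in measurable X](_ : _ = [set M : 'M[R]_n |
        forall i j, `|((M0 *m (rep z)^T) *m M) i j - M0 i j| < e]).
      by apply: MBorel_open; exact: open_box.
    by apply/seteqP; split=> M h i j; have := h i j; rewrite ?mul1mx//= mul1mx.
  have oQ : orth_mx (M0 *m (rep z)^T) by apply: orth_mul => //; exact: orth_tr.
  exact: etrans (inv _ oQ _ mU) U0.
pose W (k : nat) : set (MBorel R n) := if unpickle k is Some z then V z else set0.
have nW : mu.-negligible (\bigcup_k W k).
  apply: negligible_bigcup => k; rewrite /W; case: unpickle => [z|]; first exact: nV.
  exact: negligible_set0.
have : mu.-negligible [set: MBorel R n].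
  apply: negligibleS (negligibleU nN nW) => M _.
  have [oM|] := pselect (orth_mx M); last by left.
  right; exists (pickle (cell M)) => //; rewrite /W pickleK /V /=.
  have oR := rep_orth (cell M); have cR := rep_cell M oM.
  set Nz := rep (cell M) in oR cR *.
  move=> i j; rewrite mul1mx.
  have -> : (M0 *m Nz^T *m M) i j - M0 i j = \sum_k (M0 *m Nz^T) i k * (M k j - Nz k j).
    have {2}-> : M0 = M0 *m Nz^T *m Nz by rewrite -mulmxA oR mulmx1.
    by rewrite !mxE -sumrB; apply: eq_bigr => k _; rewrite mulrBr.
  apply: le_lt_trans Ke; apply: (le_trans (ler_norm_sum _ _ _)).
  apply: (@le_trans _ _ (\sum_(k < n) K^-1)); last first.
    by rewrite sumr_const card_ord mulr_natl.
  apply: ler_sum => k _; rewrite normrM.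
  have h1 : `|(M0 *m Nz^T) i k| <= 1.
    by apply: orth_entry; apply: orth_mul => //; exact: orth_tr.
  have h2 : `|M k j - Nz k j| <= K^-1.
    have := congr1 (fun A : 'M[int]_n => A k j) cR; rewrite !mxE => fl.
    have /andP[a1 a2] := floor_itv (M k j * K).
    have /andP[b1 b2] := floor_itv (Nz k j * K).
    rewrite fl in b1 b2; rewrite intrD in a2 b2.
    rewrite -(ler_pM2r K0) mulVf ?gt_eqF// -[X in _ * X](gtr0_norm K0) -normrM mulrBl.
    rewrite ler_norml; lra.
  by apply: (le_trans (ler_pM _ _ h1 h2)) => //; rewrite mul1r.
move=> nT; have /eqP := etrans (esym mu1) (measure_negligible measurableT nT).
by rewrite onee_eq0.
Qed.

End HaarDensity.

(** * Derivatives along lines, under rotation, and of logarithms *)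

Section DirectionalDerivatives.
Variable R : realType.

Lemma contV (T : topologicalType) (f : T -> R) : (forall x, f x != 0) ->
  continuous f -> continuous (fun x => (f x)^-1).
Proof. by move=> f0 cf x; apply: (@cvgV R); [exact: f0|exact: cf]. Qed.

Lemma is_derive_line n (f : 'rV[R]_n -> R) (u z : 'rV[R]_n) (s : R) :
  derivable f (s *: u + z) u ->
  is_derive s (1 : R) (fun t => f (t *: u + z)) ('D_u f (s *: u + z)).
Proof.
move=> df.
have E : (fun h : R => h^-1 *: (((fun t => f (t *: u + z)) \o shift s) (h *: 1) -
      f (s *: u + z))) =
    (fun h : R => h^-1 *: ((f \o shift (s *: u + z)) (h *: u) - f (s *: u + z))).
  apply/funext => h /=; congr (_ *: (f _ - _)).
  by rewrite addrA -scalerDl /GRing.scale/= mulr1.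
by apply: DeriveDef; rewrite /derivable /derive E.
Qed.

Lemma derive_mulmx n (f : 'rV[R]_n -> R) (M : 'M[R]_n) v x :
  'D_v (fun z => f (z *m M)) x = 'D_(v *m M) f (x *m M).
Proof.
have E : (fun h : R => h^-1 *: (((fun z => f (z *m M)) \o shift x) (h *: v) - f (x *m M))) =
    (fun h : R => h^-1 *: ((f \o shift (x *m M)) (h *: (v *m M)) - f (x *m M))).
  by apply/funext => h /=; rewrite mulmxDl -scalemxAl.
by rewrite /derive E.
Qed.

Lemma derive_ln_comp n (p : 'rV[R]_n -> R) x v : 0 < p x -> differentiable p x ->
  differentiable (fun z => ln (p z)) x /\
  'D_v (fun z => ln (p z)) x = 'D_v p x / p x.
Proof.
move=> p0 dp; have dl := is_derive1_ln p0.
have dln : differentiable (@ln R) (p x) by apply/derivable1_diffP; case: dl.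
have dc : differentiable (@ln R \o p) x by exact: differentiable_comp.
split=> //; rewrite (deriveE v dc) diff_comp//= diff1E// -(deriveE v dp).
by rewrite derive1E (@derive_val _ _ _ _ _ _ _ dl).
Qed.

Lemma derive_coord n (f : 'rV[R]_n -> R) x v : differentiable f x ->
  'D_v f x = \sum_i v 0 i * pd i f x.
Proof.
move=> df; rewrite (deriveE v df) {1}(row_sum_delta v) linear_sum.
by apply: eq_bigr => i _; rewrite linearZ/= /pd deriveE.
Qed.

Lemma pd0_ln_gauss n (x : 'rV[R]_n.+1) :
  pd ord0 (fun z => ln (gauss_dens z)) x = - x 0 ord0.
Proof.
pose c : R := ln ((Num.sqrt (pi *+ 2) ^+ n.+1)^-1).
have E (z : 'rV[R]_n.+1) : ln (gauss_dens z) = c - sqnorm z / 2.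
  have s0 : 0 < (Num.sqrt (pi *+ 2) ^+ n.+1 : R)^-1.
    by rewrite invr_gt0 exprn_gt0// sqrtr_gt0 mulrn_wgt0// pi_gt0.
  by rewrite /gauss_dens lnM ?posrE ?expR_gt0// expRK.
rewrite /pd /derive; apply: cvg_lim => //.
(* The factor h / h makes the identity hold at h = 0 too, where both sides are 0. *)
rewrite (_ : (fun h : R => _) = (fun h : R => (- x 0 ord0 - h / 2) * (h / h))); last first.
  apply/funext => h /=; rewrite !E.
  have -> : sqnorm (h *: delta_mx 0 ord0 + x) = sqnorm x + h * x 0 ord0 * 2 + h ^+ 2.
    rewrite /sqnorm !big_ord_recl !mxE eqxx.
    under eq_bigr do rewrite !mxE /= mulr0 add0r.
    by rewrite /=; ring.
  have -> : c - (sqnorm x + h * x 0 ord0 * 2 + h ^+ 2) / 2 - (c - sqnorm x / 2) =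
    - (h * x 0 ord0) - h * (h / 2) by field.
  by rewrite /GRing.scale/=; ring.
have : - x 0 ord0 - h / 2 @[h --> (0 : R)] --> - x 0 ord0.
  rewrite -[X in _ --> X]subr0 -[X in _ --> _ - X](mul0r 2^-1).
  apply: (@cvgB _ R^o); first exact: cvg_cst.
  by apply: (@cvgM R); [exact: cvg_id|exact: cvg_cst].
move=> /(cvg_trans (cvg_app _ (@nbhs_dnbhs _ _))) /(_ _) h.
apply: cvg_trans h; apply: near_eq_cvg; near=> h.
by rewrite divff ?mulr1//; near: h; exact: nbhs_dnbhs_neq.
Unshelve. all: by end_near. Qed.

End DirectionalDerivatives.

(** * From vanishing Fisher information to constancy of g *)

Section FisherCondition.
Variables (R : realType) (n : nat) (p : 'rV[R]_n.+1 -> R) (C : R).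
Hypothesis p_gt0 : forall x, 0 < p x.
Hypothesis p_diff : forall x, differentiable p x.
Hypothesis p_C1 : forall v : 'rV[R]_n.+1, continuous (fun x => 'D_v p x).

Let lp (z : 'rV[R]_n.+1) : R := ln (p z).

Lemma lp_diff x : differentiable lp x.
Proof. by have [] := derive_ln_comp 0 (p_gt0 x) (p_diff x). Qed.

Lemma lp_cont : continuous lp.
Proof. by move=> x; apply: differentiable_continuous; exact: lp_diff. Qed.

Lemma lp_C1 v : continuous (fun x => 'D_v lp x).
Proof.
have -> : (fun x => 'D_v lp x) = (fun x => 'D_v p x * (p x)^-1).
  by apply/funext => x; have [_] := derive_ln_comp v (p_gt0 x) (p_diff x).
apply: contM; first exact: p_C1.
apply: contV => x; first by rewrite gt_eqF.
by apply: differentiable_continuous; exact: p_diff.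
Qed.

Lemma continuous_enorm m : continuous (@enorm R m).
Proof. by apply: cont_comp (@continuous_sqnorm R m) _ => t; exact: sqrt_continuous. Qed.

(** Both sides of each inequality are continuous, so a violation at one point persists on a
    neighbourhood, where the indicator of the exceptional set is 1; its integral could not be 0. *)
Lemma leb_ae_bound (c : R) (m : nat) :
  leb_ae (fun x => `|lp x| <= c * (1 + enorm x ^+ m) /\
    enorm (grad lp x) <= c * (1 + enorm x ^+ m)) ->
  forall x, `|lp x| <= c * (1 + enorm x ^+ m) /\
    enorm (grad lp x) <= c * (1 + enorm x ^+ m).
Proof.
set P := (X in leb_ae X) => aeP x0; apply: contrapT => nP.
have cr : continuous (fun x : 'rV[R]_n.+1 => c * (1 + enorm x ^+ m)).
  apply: contM; first exact: cont_cst.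
  by apply: contD; [exact: cont_cst|apply: contX; exact: continuous_enorm].
have c1 : continuous (fun x => `|lp x| - c * (1 + enorm x ^+ m)).
  by apply: contB => //; apply: cont_comp lp_cont _; exact: (@norm_continuous _ R^o).
have c2 : continuous (fun x => enorm (grad lp x) - c * (1 + enorm x ^+ m)).
  apply: contB => //; apply: cont_comp (@continuous_enorm n.+1).
  apply: continuous_mx => i j; under eq_fun do rewrite mxE; exact: lp_C1.
have near_nP : \forall x \near x0, ~ P x.
  have pos (f : 'rV[R]_n.+1 -> R) : continuous f -> 0 < f x0 -> \forall x \near x0, 0 < f x.
    move=> cf f0; apply: (@open_nbhs_nbhs _ x0 (f @^-1` [set t | 0 < t])); split=> //.
    by apply: open_comp; [move=> x _; exact: cf|exact: open_gt].
  have [h|/negP] := boolP (`|lp x0| <= c * (1 + enorm x0 ^+ m)); last first.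
    move/negP; rewrite -ltNge -subr_gt0 => /(pos _ c1).
    by apply: filterS => x; rewrite subr_gt0 ltNge => /negP h [].
  have [h'|/negP] := boolP (enorm (grad lp x0) <= c * (1 + enorm x0 ^+ m)); first by case: nP.
  move/negP; rewrite -ltNge -subr_gt0 => /(pos _ c2).
  by apply: filterS => x; rewrite subr_gt0 ltNge => /negP h'' [].
have := @wint_eq0 R (fun=> 1) n.+1 (fun x => (\1_(~` [set y | P y]) x : R)%:E) x0 1.
apply=> //.
- exact: cont_cst.
- by apply: filterS near_nP => x nPx; rewrite indicE mem_set.
Qed.

Hypothesis lp_bound : forall x, `|lp x| <= C * expR (sqnorm x / 4).
Hypothesis grad_bound : forall x, enorm (grad lp x) <= C * expR (sqnorm x / 4).

Lemma coord_le_enorm m (x : 'rV[R]_m) i : `|x 0 i| <= enorm x.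
Proof.
rewrite /enorm -sqrtr_sqr ler_wsqrtr// /sqnorm (bigD1 i)//= lerDl.
by rewrite sumr_ge0// => k _; exact: sqr_ge0.
Qed.

Lemma derive_lp_bound v x :
  `|'D_v lp x| <= (\sum_i `|v 0 i|) * (C * expR (sqnorm x / 4)).
Proof.
rewrite derive_coord; last exact: lp_diff.
apply: (le_trans (ler_norm_sum _ _ _)); rewrite mulr_suml; apply: ler_sum => i _.
rewrite normrM ler_wpM2l//; apply: le_trans (grad_bound x).
by have := coord_le_enorm (grad lp x) i; rewrite mxE.
Qed.

Let g (x : 'rV[R]_n.+1) : R := lp x + sqnorm x / 2.

Lemma half_sqnorm_bound m (x : 'rV[R]_m) : sqnorm x / 2 <= 2 * expR (sqnorm x / 4).
Proof.
have := expR_ge1Dx (sqnorm x / 4); have := sqnorm_ge0 x; lra.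
Qed.

Lemma g_growth : gauss_growth (C + 2) g.
Proof.
apply: gauss_growthD; first by split; [exact: lp_cont|exact: lp_bound].
split; first by apply: contM; [exact: continuous_sqnorm|exact: cont_cst].
move=> x; rewrite ger0_norm ?half_sqnorm_bound//.
by rewrite divr_ge0// sqnorm_ge0.
Qed.

Let gmean : R := iterint (fun x => g x * gauss_dens x).

Lemma gauss_dens_orth m (M : 'M[R]_m) x : orth_mx M ->
  gauss_dens (x *m M) = gauss_dens x.
Proof. by move=> oM; rewrite /gauss_dens orth_sqnorm. Qed.

Lemma iterint_orth m (M : 'M[R]_m) (f : 'rV[R]_m -> R) : orth_mx M -> gauss_decay f ->
  iterint (fun x => f (x *m M)) = iterint f.
Proof.
move=> oM fd; have [_ /(_ f fd)] := det_scaling_unitmx (orth_unitmx oM).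
by rewrite orth_det// mul1r.
Qed.

(** * Consequences of zero information for a single rotation *)

Section GoodRotation.
Variable M : 'M[R]_n.+1.
Hypothesis oM : orth_mx M.
Hypothesis fisher0 : proj_fisher_gauss (rot_dens p M) = 0%E.

Let u : 'rV[R]_n.+1 := delta_mx 0 0 *m M.
Let G (x : 'rV[R]_n.+1) : R := g (x *m M).
(** The derivative of [g] along [u] at x M: the quadratic term contributes <x M, u>, which is x_0
    because M is orthogonal. *)
Let Dg (x : 'rV[R]_n.+1) : R := 'D_u lp (x *m M) + x 0 ord0.

Lemma consr_mulmx s (y : 'rV[R]_n) : consr s y *m M = s *: u + consr 0 y *m M.
Proof.
rewrite /u scalemxAl -mulmxDl; congr (_ *m M); apply/rowP => j.
have -> : (s *: (delta_mx 0 0 : 'rV[R]_n.+1) + consr 0 y) 0 j =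
    s * (j == 0)%:R + consr 0 y 0 j.
  by rewrite mxE; congr (_ + _); rewrite !mxE eqxx.
case: (unliftP ord0 j) => [k|] ->; first by rewrite !consrS /= mulr0 add0r.
by rewrite !consr0 eqxx mulr1 addr0.
Qed.

Lemma derive_G s y : is_derive s (1 : R) (fun t => G (consr t y)) (Dg (consr s y)).
Proof.
have -> : (fun t => G (consr t y)) =
    (fun t => lp (t *: u + consr 0 y *m M)) + (fun t : R => (t ^+ 2 + sqnorm y) / 2).
  by apply/funext => t; rewrite /G /g orth_sqnorm// sqnorm_consr (consr_mulmx t y).
rewrite /Dg consr0 (consr_mulmx s y); apply: is_deriveD.
  apply: is_derive_line; apply: diff_derivable; exact: lp_diff.
have -> : (fun t : R => (t ^+ 2 + sqnorm y) / 2) =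
    (fun t : R => 2^-1 * (t * t)) + cst (sqnorm y / 2).
  by apply/funext => t; rewrite !fctE/= mulrDl expr2 (mulrC _ 2^-1).
apply: is_derive_eq.
by rewrite /GRing.scale/=; field.
Qed.

Lemma G_growth : gauss_growth (C + 2) G.
Proof.
have [cg gC] := g_growth; split.
  by apply: cont_comp cg; exact: continuous_mulmxr.
by move=> x; apply: (le_trans (gC _)); rewrite orth_sqnorm.
Qed.

Lemma Dg_growth : gauss_growth ((\sum_i `|u 0 i|) * C + 4) Dg.
Proof.
apply: gauss_growthD; split.
- apply: cont_comp (@lp_C1 u); exact: continuous_mulmxr.
- move=> x; apply: (le_trans (derive_lp_bound _ _)).
  by rewrite orth_sqnorm// mulrA.
- exact: coord_continuous.
- move=> x; apply: (le_trans (coord_le_enorm _ _)).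
  have s0 := sqnorm_ge0 x.
  have : enorm x <= 1 + sqnorm x.
    rewrite /enorm -(@ger0_norm _ (1 + sqnorm x)) ?addr_ge0// -sqrtr_sqr ler_wsqrtr//.
    by nra.
  have := expR_ge1Dx (sqnorm x / 4); lra.
Qed.

Let H (t : R) : R := iterint (fun y : 'rV[R]_n => Dg (consr t y) * gauss_dens y).

Lemma score_E x : pd ord0 (fun z => ln (gauss_dens z)) x -
  pd ord0 (fun z => ln (rot_dens p M z)) x = - Dg x.
Proof.
rewrite pd0_ln_gauss /pd /rot_dens (derive_mulmx lp) /Dg opprD addrC; congr (_ - _).
Qed.

(** The slice integral with the full Gaussian weight is continuous, and H is its quotient by the
    normal density at t. *)
Lemma H_cont : continuous H.
Proof.
have e4 : 0 < 1 / 4 :> R by rewrite divr_gt0.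
have sl := iterint_slice_cont e4 (gauss_growth_bounded Dg_growth).
have -> : H = (fun t => iterint (fun y : 'rV[R]_n => Dg (consr t y) * gauss_dens (consr t y)) *
    (normal_pdf 0 1 t)^-1).
  apply/funext => t.
  have gd := gauss_growth_decay (gauss_growth_slice t Dg_growth).
  transitivity (normal_pdf 0 1 t * H t * (normal_pdf 0 1 t)^-1).
    by rewrite mulrAC mulfV ?mul1r// gt_eqF// normal_pdf01_gt0.
  rewrite -iterintZ//; congr (_ * _); apply: eq_iterint => y.
  by rewrite gauss_dens_consr mulrCA.
apply: contM => //; apply: contV => [t|]; first by rewrite gt_eqF// normal_pdf01_gt0.
by apply: continuous_normal_pdf; rewrite oner_eq0.
Qed.

Lemma wint_cst m (c : R) : wint (normal_pdf 0 1) (fun _ : 'rV[R]_m => c%:E) = c%:E.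
Proof.
rewrite wint_gaussE; last exact: gauss_growth_decay (gauss_growth_cst m c).
rewrite iterintZ ?iterint_gauss ?mulr1//.
by apply: eq_gauss_decay (gauss_growth_decay (gauss_growth_cst m 1)) => z; rewrite mul1r.
Qed.

Lemma inner_score t : gauss_exp (fun y : 'rV[R]_n.+1 =>
    (pd ord0 (fun z => ln (gauss_dens z)) (setc y ord0 t) -
     pd ord0 (fun z => ln (rot_dens p M z)) (setc y ord0 t))%:E) = (- H t)%:E.
Proof.
(* The coordinate y_0, overwritten by [setc], is still integrated: both sides become integrals over
   it of the constant - H t against the normal density. *)
rewrite /gauss_exp -[RHS](wint_cst 1 (- H t)) /=; apply: eq_integral => s _.
congr (_ * _)%E.
have sD := gauss_growth_slice t Dg_growth.
have setcE (y : 'rV[R]_n) : setc (consr s y) ord0 t = consr t y.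
  apply/rowP => j; rewrite mxE; case: (unliftP ord0 j) => [k|] ->.
    by rewrite !consrS.
  by rewrite eqxx consr0.
transitivity (wint (normal_pdf 0 1) (fun y : 'rV[R]_n => (-1 * Dg (consr t y))%:E)).
  by congr wint; apply/funext => y; rewrite mulN1r -score_E -setcE.
have gd := gauss_growth_decay sD.
rewrite wint_gaussE; last by apply: eq_gauss_decay (gauss_decayZ (-1) gd) => y; rewrite mulrA.
congr EFin; rewrite -[RHS]mulN1r /H -iterintZ//.
by apply: eq_iterint => y; rewrite mulrA.
Qed.

(** All summands of the information are nonnegative, so the first one, the Gaussian mean of
    H(x_0)^2, is zero; H being continuous, it vanishes everywhere. *)
Lemma H_eq0 t : H t = 0.
Proof.
have w0 (s : R) : 0 <= normal_pdf 0 1 s by exact: normal_pdf_ge0.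
have sq0 : wint (normal_pdf 0 1) (fun x : 'rV[R]_n.+1 => (H (x ord0 ord0) ^+ 2)%:E) = 0%E.
  have sq_ge0 (a : \bar R) : (0 <= a * a)%E by rewrite -expe2 sqre_ge0.
  move: fisher0; rewrite /proj_fisher_gauss => /eqP.
  rewrite big_ord_recl padde_eq0; last 2 first.
  - exact: wint_ge0.
  - by apply: sume_ge0 => i _; exact: wint_ge0.
  move=> /andP[/eqP + _]; rewrite {1}/gauss_exp => <-.
  congr wint; apply/funext => x.
  by rewrite -/(gauss_exp _) inner_score -EFinM mulrNN expr2.
apply/eqP; apply: contrapT => /negP Ht.
have H2 : 0 < H t ^+ 2 / 2 by rewrite divr_gt0// exprn_even_gt0.
have := @wint_eq0 R (normal_pdf 0 1) n.+1 (fun x => (H (x ord0 ord0) ^+ 2)%:E)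
  (consr t 0) (H t ^+ 2 / 2).
apply=> //.
- by apply: continuous_normal_pdf; rewrite oner_eq0.
- exact: normal_pdf01_gt0.
- by move=> x; rewrite lee_fin sqr_ge0.
pose f (x : 'rV[R]_n.+1) := H (x ord0 ord0) ^+ 2.
have cf : continuous f.
  apply: contX; apply: cont_comp H_cont; exact: coord_continuous.
have : nbhs (consr t (0 : 'rV[R]_n)) (f @^-1` [set r | H t ^+ 2 / 2 < r]).
  apply: open_nbhs_nbhs; split; last first.
    by rewrite /= /f consr0; move: H2; lra.
  by apply: open_comp; [move=> x _; exact: cf|exact: open_gt].
by apply: filterS => x /= hx; rewrite lee_fin ltW.
Qed.

(** The slice argument runs in rotated coordinates x, where the test function depends on x_0 = <x M,
    u>; rotation invariance of the Gaussian integral brings it back to the original ones. *)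
Lemma good_ridge (s b : R) :
  iterint (fun x => (g x - gmean) * cos (dot x (s *: u) + b) * gauss_dens x) = 0.
Proof.
have [K GK DK] : exists2 K, gauss_growth K G & gauss_growth K Dg.
  have [cG GC] := G_growth; have [cD DC] := Dg_growth.
  exists (Num.max (C + 2) ((\sum_i `|u 0 i|) * C + 4)); split=> // x.
    by apply: (le_trans (GC x)); rewrite ler_wpM2r ?expR_ge0// le_max lexx.
  by apply: (le_trans (DC x)); rewrite ler_wpM2r ?expR_ge0// le_max lexx orbT.
have := ridge_orthogonal (fun t => cos (s * t + b)) GK DK derive_G H_eq0.
have -> : iterint (fun z => G z * gauss_dens z) = gmean.
  rewrite /gmean -(iterint_orth oM (gauss_growth_decay g_growth)); apply: eq_iterint => x.
  by rewrite gauss_dens_orth.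
have fd : gauss_decay (fun x => (g x - gmean) * cos (dot x (s *: u) + b) * gauss_dens x).
  apply: (gauss_growth_decay (C := (C + 2 + `|- gmean|) * 1)); apply: gauss_growth_bound.
  - by apply: gauss_growthD; [exact: g_growth|exact: gauss_growth_cst].
  - exact: cont_cosdot.
  - by move=> x; exact: cos_max.
rewrite -(iterint_orth oM fd) => <-; apply: eq_iterint => x.
rewrite gauss_dens_orth// dotZr; congr (_ * cos (_ * _ + _) * _).
have dotE (a v : 'rV[R]_n.+1) : dot a v = (a *m v^T) 0 0.
  by rewrite /dot mxE; apply: eq_bigr => i _; rewrite mxE.
rewrite dotE /u trmx_mul mulmxA -(mulmxA x) orth_mxT// mulmx1.
by rewrite -dotE dot_delta.
Qed.

End GoodRotation.

Variable mu : {measure set (MBorel R n.+1) -> \bar R}.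
Hypothesis mu_haar : is_haar_On mu.
Hypothesis fisher_ae : {ae mu, forall M : MBorel R n.+1,
  orth_mx M -> proj_fisher_gauss (rot_dens p M) = 0%E}.

(** w is a multiple of the first row of some orthogonal M0, which is a limit of qualifying matrices;
    the integrands share one Gaussian bound, so the identity passes to the limit. *)
Lemma all_ridge (w : 'rV[R]_n.+1) (b : R) :
  iterint (fun x => (g x - gmean) * cos (dot x w + b) * gauss_dens x) = 0.
Proof.
have [M0 [s [oM0 wE]]] : exists M0 s, orth_mx M0 /\ w = s *: row 0 M0.
  have [w0|w0] := eqVneq (enorm w) 0.
    exists 1%:M, 0; split; first exact: orth1.
    apply/rowP => i; rewrite scale0r mxE; apply/eqP; rewrite -normr_le0 -w0.
    exact: coord_le_enorm.
  have [|M0 oM0 rM0] := @orth_row0 R n ((enorm w)^-1 *: w).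
    have e2 : enorm w ^+ 2 = sqnorm w by rewrite sqr_sqrtr// sqnorm_ge0.
    by rewrite sqnormZ -e2 exprVn mulVf// expf_neq0.
  by exists M0, (enorm w); rewrite rM0 scalerA mulfV// scale1r.
have /choice[M_ hM] : forall k : nat, exists M : 'M[R]_n.+1, [/\ orth_mx M,
    orth_mx M -> proj_fisher_gauss (rot_dens p M) = 0%E &
    forall i j, `|M i j - M0 i j| < k.+1%:R^-1].
  by move=> k; apply: (haar_dense mu_haar fisher_ae oM0); rewrite invr_gt0.
have e4 : 0 < 1 / 4 :> R by rewrite divr_gt0.
pose T (v : 'rV[R]_n.+1) (x : 'rV[R]_n.+1) : R :=
  (g x - gmean) * cos (dot x v + b) * gauss_dens x.
have gT v : gauss_bounded ((C + 2 + `|- gmean|) * 1 * gpeak R n.+1) (1 / 4) (T v).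
  apply: gauss_growth_bounded; apply: gauss_growth_bound.
  - by apply: gauss_growthD; [exact: g_growth|exact: gauss_growth_cst].
  - exact: cont_cosdot.
  - by move=> x; exact: cos_max.
have lim : iterint (T (s *: row 0 (M_ k))) @[k --> \oo] --> iterint (T w).
  apply: (iterint_dct e4) => // x; apply: (@cvgM R); last exact: cvg_cst.
  apply: (@cvgM R); first exact: cvg_cst.
  apply: (@continuous_cvg _ _ _ _ _ (fun k => dot x (s *: row 0 (M_ k)) + b) cos).
    exact: continuous_cos.
  apply: (@cvgD _ R^o); last exact: cvg_cst.
  rewrite wE dotZr; under eq_fun do rewrite dotZr.
  apply: (@cvgM R); first exact: cvg_cst.
  apply: cvgr_sum => i; apply: (@cvgM R); first exact: cvg_cst.
  rewrite mxE; under eq_fun do rewrite mxE.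
  apply/cvgrPdist_le => e e0; near=> k.
  have [_ _ /(_ 0 i) h] := hM k; rewrite distrC (le_trans (ltW h))//.
  by apply: ltW; near: k; exact: near_infty_natSinv_lt (PosNum e0).
have zero : (fun k => iterint (T (s *: row 0 (M_ k)))) = (fun=> 0).
  apply/funext => k; have [oM fM _] := hM k.
  by rewrite -[RHS](good_ridge oM (fM oM) s b) /T rowE.
rewrite zero in lim.
by have := cvg_unique _ lim (cvg_cst (0 : R)); exact.
Unshelve. all: by end_near. Qed.

Lemma g_constant x : g x = gmean.
Proof.
have sg : gauss_growth (C + 2 + `|- gmean|) (fun z => g z - gmean).
  by apply: gauss_growthD; [exact: g_growth|exact: gauss_growth_cst].
by apply/eqP; rewrite -subr_eq0; apply/eqP; exact: (ridge_injective sg all_ridge).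
Qed.

Lemma dens_gauss : leb_int (fun x => (p x)%:E) = 1%E -> forall x, p x = gauss_dens x.
Proof.
(* Constancy of g reads p = exp(gmean) exp(-|x|^2 / 2), which is K times gamma; both densities have
   mass 1, so K = 1. *)
pose K : R := expR gmean * Num.sqrt (pi *+ 2) ^+ n.+1.
have s0 : 0 < Num.sqrt (pi *+ 2) :> R by rewrite sqrtr_gt0 mulrn_wgt0// pi_gt0.
have pE x : p x = K * gauss_dens x.
  rewrite /K /gauss_dens mulrA mulfK ?expf_neq0 ?gt_eqF//.
  rewrite -expRD -(g_constant x) /g addrK /lp lnK ?posrE//.
have gd : gauss_decay (@gauss_dens R n.+1).
  by apply: eq_gauss_decay (gauss_growth_decay (gauss_growth_cst n.+1 1)) => z; rewrite mul1r.
rewrite (funext pE) /leb_int wint1E; last exact: gauss_decayZ.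
by rewrite iterintZ// iterint_gauss mulr1 => -[->] x; rewrite mul1r.
Qed.

End FisherCondition.

Theorem theorem1 (R : realType) (d : nat) (p : 'rV[R]_d -> R)
  (mu : {measure set (MBorel R d) -> \bar R}) :
  (* standing assumptions on p *)
  (forall x, 0 < p x) ->
  (forall x, differentiable p x) ->
  (forall v : 'rV[R]_d, continuous (fun x => 'D_v p x)) ->
  leb_int (fun x => (p x)%:E) = 1%E ->
  (exists (c : R) (m : nat), 0 < c /\ (2 <= m)%N /\
     leb_ae (fun x : 'rV[R]_d =>
       `|ln (p x)| <= c * (1 + enorm x ^+ m) /\
       enorm (grad (fun z => ln (p z)) x) <= c * (1 + enorm x ^+ m))) ->
  (* mu is the Haar measure of O(d) *)
  is_haar_On mu ->
  (* tI(gamma, p_R) = 0 for mu-almost every orth_mx R *)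
  {ae mu, forall Rm : MBorel R d,
     orth_mx Rm -> proj_fisher_gauss (rot_dens p Rm) = 0%E} ->
  forall x, p x = gauss_dens x.
Proof.
case: d p mu => [|n] p mu p0 dp cp p1 [c [m [c0 [_ bnd]]]] haar fisher x.
  (* In dimension 0 the integral is evaluation at the only point, so the normalisation of p is
     already the claim. *)
  rewrite gauss_dens_rV0 (_ : x = 0); last by apply/rowP => -[].
  by case: p1.
have [K K0 hK] := poly_growth R m.
have bnd' := leb_ae_bound p0 dp cp bnd.
apply: (@dens_gauss R n p (c * K) p0 dp cp _ _ mu haar fisher p1) => z.
- by have [b _] := bnd' z; apply: (le_trans b); rewrite -mulrA ler_pM2l.
- by have [_ b] := bnd' z; apply: (le_trans b); rewrite -mulrA ler_pM2l.
Qed.
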